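(* Let $\alpha$ be an ordinal, let $F$ be a field, and let $D=S^{-1}F[\mathbf{X}]$ be the integral domain constructed from $\alpha$ and $F$ in the context. Then $D$ is an almost Dedekind domain of SP-rank $\alpha$.
   Context: Conventions. $\mathbb{N}=\{1,2,\dots\}$ and $\mathbb{N}_0=\mathbb{N}\cup\{0\}$; the ordinal $0$ is neither a successor nor a limit ordinal. For an ordinal $\beta$, $\mathrm{Sc}(\beta)$ (resp. $\mathrm{Lim}(\beta)$) is the set of successor (resp. limit) ordinals smaller than $\beta$. Index sets. Put $\xi:=\max\{\omega,\alpha\}$ and let $\xi^{\alpha\setminus\{0\}}$ be the set of sequences $t=(t_\gamma)_{0<\gamma<\alpha}$ of ordinals $t_\gamma<\xi$. For $\beta<\alpha$ let $\tau_\beta(t)$ be the sequence with $(\tau_\beta(t))_\gamma=t_\gamma$ if $\gamma\geq\beta+1$ and $(\tau_\beta(t))_\gamma=0$ otherwise. For $0<\beta<\alpha$ let $e_\beta$ be the sequence with entry $1$ at $\beta$ and $0$ elsewhere; $t+\delta e_\beta$ denotes $t$ with the entry at $\beta$ replaced by $t_\beta+\delta$. For $\beta\in\mathrm{Sc}(\alpha)\cup\{0\}$, $U_\beta$ is the set of all $t\in\xi^{\alpha\setminus\{0\}}$ with only finitely many nonzero components such that $t_\gamma\in\mathbb{N}_0$ for every $\gamma\in\mathrm{Sc}(\alpha)$ and $t_\delta=0$ for all $\delta<\beta$. For $\beta\in\mathrm{Lim}(\alpha)$, $U_\beta$ is defined in the same way with the additional requirement $t_\beta<\beta$. Graph. $\mathcal{T}$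 is the directed graph with vertices $X_{\beta,t}$ ($\beta<\alpha$, $t\in U_\beta$) and exactly the following edges: if $\beta=\gamma+1\in\mathrm{Sc}(\alpha)$ and $t\in U_\beta$, the edges $(X_{\beta,t},X_{\gamma,t+ke_\beta})$ for $k\in\mathbb{N}$; if $\beta\in\mathrm{Lim}(\alpha)$ and $t\in U_\beta$, the edges $(X_{\beta,t},X_{\gamma,\tau_\beta(t)})$ for $\gamma\in\mathrm{Sc}(\beta)$ with $t_\beta<\gamma$. Let $\mathbf{X}_\beta=\{X_{\beta,t}:t\in U_\beta\}$ (elements of height $\beta$) and $\mathbf{X}=\bigcup_{\beta<\alpha}\mathbf{X}_\beta$. Domain $F[\mathbf{X}]$. The elements of $\mathbf{X}_0$ are regarded as independent indeterminates over $F$, and one considers formal (possibly infinite) products $\prod_{r\in U_0}X_{0,r}^{n_r}$, $n_r\in\mathbb{N}_0$, multiplied by adding exponents. By recursion on the height, each $X\in\mathbf{X}\setminus\mathbf{X}_0$ is identified with the formal product $X:=\prod_{(X,Y)\in\mathcal{T}}Y^2$ over all edges $(X,Y)$ starting at $X$ (well defined, since each $X_{0,r}$ occurs in at most one of the factors). Explicitly, $X_{\beta,t}=\prod_{i\in\mathbb{N}}X_{\gamma,t+ie_\beta}^2$ if $\beta=\gamma+1$, and $X_{\beta,t}=\prod_{t_\beta<\gamma\in\mathrm{Sc}(\beta)}X_{\gamma,\tau_\beta(t)}^2$ if $\beta$ is a limit ordinal. A monomial is a finite product $Y_1\cdots Y_n$ with $n\in\mathbb{N}_0$ and $Y_i\in\mathbf{X}$.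 $F[\mathbf{X}]$ is the monoid algebra over $F$ of the monoid of all monomials (so the monomials form an $F$-basis); it is an integral domain. Domain $D$. Let $S$ be the set of all elements of $F[\mathbf{X}]$ not divisible in $F[\mathbf{X}]$ by a proper monomial (a monomial other than $1$); it is a multiplicative subset, and $D:=S^{-1}F[\mathbf{X}]$. SP-rank. A domain $D$ is almost Dedekind if $D_M$ is a discrete valuation ring for every $M\in\mathrm{Max}(D)$ (the set of maximal ideals). A maximal ideal $M$ of an almost Dedekind domain $D$ is critical if every finitely generated ideal $I\subseteq M$ is contained in the square of some maximal ideal of $D$; $\mathrm{Crit}(D)$ is the set of critical maximal ideals. Define recursively: $T_0:=D$, $\mathrm{Crit}^0(D):=\mathrm{Max}(D)$; $\mathrm{Crit}^{\beta+1}(D):=\{P\in\mathrm{Max}(D)\mid PT_\beta\in\mathrm{Crit}(T_\beta)\}$; $\mathrm{Crit}^{\lambda}(D):=\bigcap_{\beta<\lambda}\mathrm{Crit}^\beta(D)$ for $\lambda$ a limit ordinal; and $T_\beta:=\bigcap\{D_M\mid M\in\mathrm{Crit}^\beta(D)\}$ (the empty intersection being the quotient field). The SP-rank of $D$ is the smallest ordinal $\beta$ with $\mathrm{Crit}^\beta(D)=\emptyset$.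
   Formalization: The ordinal α is assumed to be nonzero: for α = 0 the set X is empty, so 0 lies in S and D is the zero ring (or, with 0 removed from S, the field F, which is not almost Dedekind here and has no SP-rank). *)

(* Defs.v *)
From HB Require Import structures.
From mathcomp Require Import all_boot all_order all_algebra fraction.
From mathcomp Require Import finmap boolp classical_sets functions.
From mathcomp Require Import cardinality fsbigop wochoice.
From mathcomp Require Import monalg.

Set Implicit Arguments.
Unset Strict Implicit.
Unset Printing Implicit Defensive.

Import Order.TTheory GRing.Theory Num.Theory.

Local Open Scope classical_set_scope.
Local Open Scope order_scope.

(* Ordinals are the elements of an arbitrary well-ordered type closed under
   successor; such an element stands for the order type of the elements below
   it.  Every ordinal occurs in such a type: see [ordinal_occurs] below for
   the nonzero ones. *)
HB.mixin Record isOrdinals d W of Order.BTotal d W := {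
  osucc : W -> W;
  osucc_le : forall x y : W, (osucc x <= y) = (x < y);
  ord_well_order : well_order (<=%O : rel W)
}.

#[short(type="ordinalsType")]
HB.structure Definition Ordinals d := { W of isOrdinals d W & Order.BTotal d W }.

Section Ordinals.
Context {d : Order.disp_t} {W : ordinalsType d}.
Implicit Types beta gamma : W.

Definition is_succ beta := exists gamma, beta = osucc gamma.
Definition is_limit beta := beta <> \bot /\ ~ is_succ beta.
Definition Sc beta : set W := [set gamma | gamma < beta /\ is_succ gamma].
Definition Lim beta : set W := [set gamma | gamma < beta /\ is_limit gamma].

(* [oadd beta n] is the ordinal sum beta + n. *)
Definition oadd beta (n : nat) : W := iter n osucc beta.

Definition is_natural beta := exists n, beta = oadd \bot n.

Lemma ord_lt_wf : well_founded (fun x y : W => is_true (x < y)).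
Proof.
set lt := (fun x y : W => is_true (x < y)) => x; apply: contrapT => nx.
pose A : {pred W} := fun y => `[< ~ Acc lt y >].
have /ord_well_order[z [[/asboolP nz zmin] _]] : nonempty A.
  by exists x; apply/asboolP.
apply: nz; constructor => y yz; apply: contrapT => ny.
have /zmin : y \in A by apply/asboolP.
by rewrite leNgt [y < z]yz.
Qed.

Lemma lt_osucc beta : beta < osucc beta.
Proof. by rewrite -osucc_le. Qed.

Lemma lt_osuccr beta gamma : (beta < osucc gamma) = (beta <= gamma).
Proof. by rewrite ltNge osucc_le -leNgt. Qed.

Lemma osucc_inj : injective (@osucc d W).
Proof.
by move=> x y e; apply/le_anti; rewrite -!lt_osuccr -{1}e lt_osucc e lt_osucc.
Qed.

Lemma osucc_neq0 beta : osucc beta != \bot.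
Proof. by rewrite -lt0x; apply: le_lt_trans (lt_osucc beta); rewrite le0x. Qed.

End Ordinals.

(* If A has order type alpha > 0, then nat *lexi A has order type
   alpha * omega, which exceeds alpha. *)
Lemma ordinal_occurs (d : Order.disp_t) (A : bOrderType d) :
  well_order (<=%O : rel A) ->
  exists (d' : Order.disp_t) (W : ordinalsType d') (alpha : W) (f : A -> W),
    {mono f : x y / x <= y} /\ range f = [set beta | beta < alpha].
Proof.
move=> woA; pose B : orderType _ := nat *l A.
have ex_min (P : B -> Prop) w : P w -> exists2 z, P z & forall y, P y -> z <= y.
  case: w => n a Pna.
  have [m /asboolP[b Pmb] mP] :
      {m : nat | `[< exists b, P (m, b) >] &
                 forall n, `[< exists b, P (n, b) >] -> (m <= n)%N}.
    have ex : exists m, `[< exists b, P (m, b) >].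
      by exists n; apply/asboolP; exists a.
    by exists (ex_minn ex); case: ex_minnP.
  pose A' : {pred A} := fun b => `[< P (m, b) >].
  have /woA[c [[/asboolP Pmc cP] _]] : nonempty A' by exists b; apply/asboolP.
  exists (m, c) => // -[k e] Pke; rewrite leEprodlexi /=.
  have mk : (m <= k)%N by apply: mP; apply/asboolP; exists e.
  rewrite leEnat mk /=; apply/implyP => km; apply: cP.
  apply/asboolP; suff -> : m = k by [].
  by apply/eqP; rewrite eqn_leq mk.
have woB : well_order (<=%O : rel B).
  apply: antisymmetric_well_order; first exact: le_anti.
  move=> P [w Pw]; have [z Pz zP] := @ex_min (fun w => w \in P) w Pw.
  by exists z; split.
have ex_succ (x : B) : {y : B | forall z, (y <= z) = (x < z)}.
  apply: cid; have xlt : x < ((x.1.+1, x.2) : B).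
    by rewrite ltEprodlexi /= leEnat leqnSn /= ltnn.
  have [y xy yP] := @ex_min (fun y => x < y) _ xlt.
  exists y => z; apply/idP/idP => [|/yP //]; exact: lt_le_trans.
have B0 (x : B) : ((0%N, \bot) : B) <= x.
  rewrite leEprodlexi; apply/andP; split; first exact: leq0n.
  by apply/implyP => _; exact: le0x.
pose bot := Order.hasBottom.Build _ B B0.
pose B' : bOrderType _ := HB.pack B bot.
pose mix := isOrdinals.Build _ B' (fun x => projT2 (ex_succ x)) woB.
pose W : ordinalsType _ := HB.pack B' mix.
exists _, W, ((1%N, \bot) : B), (fun a => (0%N, a) : B); split=> [x y|].
  by rewrite [LHS](leEprodlexi).
apply/seteqP; split=> [_ [a _ <-]|[n a]] /=; rewrite [_ < _]ltEprodlexi /=.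
  by [].
by case: n => [_|n]; [exists a | rewrite leEnat; case: n => //; rewrite ltx0].
Qed.

Section Graph.
Context {d : Order.disp_t} {W : ordinalsType d} (alpha : W).
Implicit Types (beta gamma delta : W) (t : W -> W) (p q : W * (W -> W)).

(* Order relation with xi = max{omega, alpha}, which need not lie in W. *)
Definition lt_xi beta := is_natural beta \/ beta < alpha.

(* A sequence (t_gamma)_(0 < gamma < alpha) is a function on W that vanishes
   outside of its index set. *)
Definition index_seq : set (W -> W) :=
  [set t | (forall gamma, lt_xi (t gamma)) /\
           (forall gamma, ~ (\bot < gamma < alpha) -> t gamma = \bot)].

Definition Uset beta : set (W -> W) :=
  [set t | [/\ index_seq t,
               finite_set [set gamma | t gamma != \bot],
               forall gamma, Sc alpha gamma -> is_natural (t gamma),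
               forall delta, delta < beta -> t delta = \bot &
               Lim alpha beta -> t beta < beta]].

(* t + n e_beta *)
Definition seq_add t beta (n : nat) : W -> W :=
  fun gamma => if gamma == beta then oadd (t gamma) n else t gamma.

Definition tau beta t : W -> W :=
  fun gamma => if osucc beta <= gamma then t gamma else \bot.

(* The pair (beta, t) stands for X_{beta,t}. *)
Definition vertices : set (W * (W -> W)) :=
  [set p | p.1 < alpha /\ Uset p.1 p.2].

Definition edge p q : Prop :=
  vertices p /\
  ((exists gamma k, [/\ p.1 = osucc gamma, (0 < k)%N &
                        q = (gamma, seq_add p.2 p.1 k)]) \/
   (is_limit p.1 /\
    exists gamma, [/\ Sc p.1 gamma, p.2 p.1 < gamma & q = (gamma, tau p.1 p.2)])).

(* A formal product of indeterminates X_{0,r} is its exponent function, of type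
   [set_type (Uset \bot) -> nat].  [exponent p] is that of the vertex p: the
   indicator of r if p is X_{0,r}, and the sum of 2 * exponent q over the edges
   (p, q) if p has height > 0.  For each r at most one term of this sum is
   nonzero, so that the finitely supported sum \big[addn/0]_(q \in _) is the
   intended one.  The recursion is on the height; see [exponent0] and
   [exponent_edge]. *)
Definition exponent_step beta
    (rec : forall gamma, gamma < beta -> (W -> W) -> set_type (Uset \bot) -> nat)
    t (r : set_type (Uset \bot)) : nat :=
  if beta == \bot then nat_of_bool (val r == t)
  else \big[addn/0%N]_(q \in [set q | edge (beta, t) q])
         (2 * (if pselect (q.1 < beta)%O is left h then rec q.1 h q.2 r else 0))%N.

Definition exponent p : set_type (Uset \bot) -> nat :=
  Fix ord_lt_wf (fun _ => (W -> W) -> set_type (Uset \bot) -> nat) exponent_step p.1 p.2.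

Lemma exponentE p r :
  exponent p r =
  exponent_step (fun gamma (_ : gamma < p.1) s => exponent (gamma, s)) p.2 r.
Proof.
rewrite /exponent Fix_eq //= => beta f g fg.
by congr exponent_step; do 2!apply: functional_extensionality_dep => ?.
Qed.

Lemma exponent0 t r : exponent (\bot, t) r = (val r == t).
Proof. by rewrite exponentE /exponent_step /= eqxx. Qed.

Lemma edge_height p q : edge p q -> q.1 < p.1.
Proof.
case=> _ [[gamma [k [-> _ ->]]]|[_ [gamma [[] ? _ _ ->]]]] //=.
exact: lt_osucc.
Qed.

Lemma exponent_edge p r : p.1 != \bot ->
  exponent p r =
  \big[addn/0%N]_(q \in [set q | edge p q]) (2 * exponent q r)%N.
Proof.
case: p => beta t /= b0; rewrite exponentE /exponent_step /= (negPf b0).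
apply: eq_fsbigr => q; rewrite inE /= => /edge_height /= qb.
by case: pselect => // ?; case: q qb.
Qed.

Definition is_monomial : set (set_type (Uset \bot) -> nat) :=
  [set f | exists2 s : seq (W * (W -> W)), (forall p, p \in s -> vertices p) &
             f = fun r => (\sum_(p <- s) exponent p r)%N].

Definition monomial := set_type is_monomial.
HB.instance Definition _ := Choice.on monomial.

Lemma monomial_one_subproof : (fun=> 0%N) \in is_monomial.
Proof. by rewrite inE; exists [::] => //; apply/funext => r; rewrite big_nil. Qed.

Lemma monomial_mul_subproof (m n : monomial) :
  (fun r => val m r + val n r)%N \in is_monomial.
Proof.
case: m n => m /= /set_mem [s sV ->] [n /= /set_mem [s' s'V ->]].
rewrite inE; exists (s ++ s'); last by apply/funext => r; rewrite big_cat.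
by move=> p; rewrite mem_cat => /orP[/sV|/s'V].
Qed.

Definition monomial_one : monomial := SigSub monomial_one_subproof.
Definition monomial_mul (m n : monomial) : monomial :=
  SigSub (monomial_mul_subproof m n).

Lemma monomial_mulA : associative monomial_mul.
Proof. by move=> x y z; apply/val_inj/funext => r /=; rewrite addnA. Qed.
Lemma monomial_mulC : commutative monomial_mul.
Proof. by move=> x y; apply/val_inj/funext => r /=; rewrite addnC. Qed.
Lemma monomial_mul1m : left_id monomial_one monomial_mul.
Proof. by move=> x; apply/val_inj/funext => r. Qed.
Lemma monomial_mulm1 : right_id monomial_one monomial_mul.
Proof. by move=> x; rewrite monomial_mulC monomial_mul1m. Qed.
Lemma monomial_unitm x y :
  monomial_mul x y = monomial_one -> x = monomial_one /\ y = monomial_one.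
Proof.
move/(congr1 val) => /= e.
have {}e r : (val x r + val y r)%N == 0%N by rewrite (congr1 (@^~ r) e).
by split; apply/val_inj/funext => r /=; move: (e r); rewrite addn_eq0;
  case/andP=> /eqP ? /eqP ?.
Qed.

HB.instance Definition _ := Choice_isMonomialDef.Build monomial
  monomial_mulA monomial_mul1m monomial_mulm1 monomial_unitm.
HB.instance Definition _ := MonomialDef_isConomialDef.Build monomial monomial_mulC.

End Graph.

Arguments is_monomial {d W} alpha.
Arguments exponent {d W} alpha p r.

(* F[X] *)
Definition polyX {d : Order.disp_t} {W : ordinalsType d} (alpha : W) (F : fieldType) :=
  {malg F[monomial alpha]}.

Section Domain.
Context {d : Order.disp_t} {W : ordinalsType d} (alpha : W) (F : fieldType).
Local Open Scope ring_scope.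

HB.instance Definition _ := GRing.ComNzRing.on (polyX alpha F).

(* The exponent functions are ordered lexicographically along a well-ordering
   of the indeterminates; the leading monomials of two nonzero elements then
   show that their product is nonzero. *)
Let I := set_type (Uset alpha \bot).
Let R : rel I := projT1 (well_ordering_principle I).

Let lexlt (m n : monomial alpha) :=
  exists2 r : I, (val m r < val n r)%N &
    forall s, s != r -> R s r -> val m s = val n s.

Let R_min (P : I -> Prop) r0 : P r0 ->
  exists2 r, P r & forall s, P s -> R r s.
Proof.
move=> Pr0; pose A : {pred I} := fun r => `[< P r >].
have /(projT2 (well_ordering_principle I))[r [[/asboolP Pr rm] _]] : nonempty A.
  by exists r0; apply/asboolP.
by exists r => // s Ps; apply: rm; apply/asboolP.
Qed.

Let R_total x y : R x y \/ R y x.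
Proof.
have [r + rm] := @R_min (fun w => w = x \/ w = y) x (or_introl erefl).
by move=> /= [] e; [left|right]; rewrite -{1}e; apply: rm; auto.
Qed.

Let R_anti x y : R x y -> R y x -> x = y.
Proof.
move=> xy yx; pose A : {pred I} := fun w => (w == x) || (w == y).
have Rxx z : R z z by case: (R_total z z).
have /(projT2 (well_ordering_principle I))[z [_ zu]] : nonempty A.
  by exists x; rewrite unfold_in /A eqxx.
have xz : z = x.
  by apply: zu; split=> [|w]; rewrite unfold_in /A ?eqxx // => /orP[]/eqP->.
rewrite -xz; apply: zu.
by split=> [|w]; rewrite unfold_in /A ?eqxx ?orbT // => /orP[]/eqP->.
Qed.

Let R_trans x y z : R x y -> R y z -> R x z.
Proof.
have [r + rm] := @R_min (fun w => [\/ w = x, w = y | w = z]) x (Or31 _ _ erefl).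
have rx : R r x by apply: rm; constructor 1.
have ry : R r y by apply: rm; constructor 2.
have rz : R r z by apply: rm; constructor 3.
case=> e; rewrite e in rx ry rz => //.
  by move=> xy; rewrite (R_anti xy rx).
by move=> xy yz; rewrite -(R_anti yz ry).
Qed.

Let lexlt_total m n : m != n -> lexlt m n \/ lexlt n m.
Proof.
move=> mn; have [r0 r0P] : exists r, val m r <> val n r.
  apply: contrapT => nr; case/eqP: mn; apply/val_inj/funext => r.
  by apply: contrapT => ?; apply: nr; exists r.
have [r rP rm] := @R_min (fun r => val m r <> val n r) r0 r0P.
have e s : s != r -> R s r -> val m s = val n s.
  move=> sr Rsr; apply: contrapT => /rm Rrs.
  by case/eqP: sr; apply: R_anti.
have [h|h|//] := ltngtP (val m r) (val n r); [left|right]; exists r => // s sr Rsr.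
by rewrite e.
Qed.

Let lexlt_trans m n p : lexlt m n -> lexlt n p -> lexlt m p.
Proof.
move=> [r lr er] [r' lr' er'].
have [rr'|rr'] := eqVneq r r'.
  rewrite -rr' in lr' er'; exists r; first exact: ltn_trans lr'.
  by move=> s sr Rs; rewrite er // er'.
have [h|h] := R_total r r'.
  exists r; first by rewrite -er'.
  move=> s sr Rs; rewrite er // er' //; last exact: R_trans h.
  by apply/eqP => sr'; case/eqP: rr'; apply: R_anti => //; rewrite -sr'.
exists r'; first by rewrite er // eq_sym.
move=> s sr' Rs; rewrite er ?er' //; last exact: R_trans h.
by apply/eqP => sr; case/eqP: rr'; apply: R_anti => //; rewrite -sr.
Qed.

Let lexlt_irr m : ~ lexlt m m.
Proof. by case=> r; rewrite ltnn. Qed.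

Let lexlt_mulr m n k : lexlt m n -> lexlt (monomial_mul m k) (monomial_mul n k).
Proof.
case=> r lr er; exists r; first by rewrite /= ltn_add2r.
by move=> s sr Rs; rewrite /= er.
Qed.

Let lexlt_mul m n m' n' : (m = m' \/ lexlt m m') -> (n = n' \/ lexlt n n') ->
  monomial_mul m n = monomial_mul m' n' -> m = m' /\ n = n'.
Proof.
have mulC := @monomial_mulC _ _ alpha.
case=> [<-|mm'] [<-|nn'] // e.
- by case: (@lexlt_irr (monomial_mul n' m)); rewrite {1}[_ n' m]mulC -e mulC;
    exact: lexlt_mulr.
- by case: (@lexlt_irr (monomial_mul m' n)); rewrite -{1}e; exact: lexlt_mulr.
- case: (@lexlt_irr (monomial_mul m' n')); rewrite -{1}e.
  apply: lexlt_trans (lexlt_mulr n mm') _.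
  by rewrite mulC [X in lexlt _ X]mulC; exact: lexlt_mulr.
Qed.

Let lexlt_max (s : seq (monomial alpha)) : s != [::] ->
  exists2 m, m \in s & forall n, n \in s -> n = m \/ lexlt n m.
Proof.
elim: s => // x [|y s] IH _.
  by exists x; rewrite ?inE // => n; rewrite inE => /eqP; left.
have [//|m ms mP] := IH.
have [xm|xm] := eqVneq x m.
  exists m; first by rewrite inE ms orbT.
  by move=> n; rewrite inE => /predU1P[->|/mP]; [left|].
have [h|h] := lexlt_total xm.
  exists m; first by rewrite inE ms orbT.
  by move=> n; rewrite inE => /predU1P[->|/mP]; [right|].
exists x; first by rewrite inE eqxx.
move=> n; rewrite inE => /predU1P[->|/mP[->|]]; [by left|by right|].
by move=> /lexlt_trans/(_ h); right.
Qed.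

Lemma polyX_integral (f g : polyX alpha F) : f * g = 0 -> (f == 0) || (g == 0).
Proof.
move=> fg; apply/norP => -[f0 g0].
have supp0 (h : polyX alpha F) : h != 0 -> msupp h != [::] :> seq _.
  rewrite -msupp_eq0 => /fset0Pn[k]; rewrite -[k \in _]/(k \in enum_fset _).
  by case: enum_fset.
have [m ms mP] := lexlt_max (supp0 _ f0).
have [n ns nP] := lexlt_max (supp0 _ g0).
have := congr1 (mcoeff (monomial_mul m n)) fg.
rewrite mcoeff0 mcoeffMl (bigD1_seq m) ?fset_uniq //=.
rewrite (bigD1_seq n) ?fset_uniq //= eqxx mulr1n.
rewrite !big1_seq ?addr0.
- by apply/eqP; rewrite mulf_neq0 // mcoeff_neq0.
- move=> k /andP[km kf]; rewrite big1_seq // => l /andP[_ lg].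
  case: eqP => // /(lexlt_mul (mP _ kf) (nP _ lg))[e _].
  by rewrite e eqxx in km.
- move=> k /andP[kn kg]; case: eqP => // /(lexlt_mul (or_introl erefl) (nP _ kg))[_ e].
  by rewrite e eqxx in kn.
Qed.

Let unitX : {pred polyX alpha F} := fun f => `[< exists g, g * f = 1 >].
Let invX (f : polyX alpha F) : polyX alpha F :=
  if pselect (exists g, g * f = 1) is left h then projT1 (cid h) else f.

Let mulVX : {in unitX, left_inverse 1 invX *%R}.
Proof.
by move=> f /asboolP h; rewrite /invX; case: pselect => // h'; case: cid.
Qed.
Let unitXP (f g : polyX alpha F) : g * f = 1 -> unitX f.
Proof. by move=> gf; apply/asboolP; exists g. Qed.
Let invX_out : {in [predC unitX], invX =1 id}.
Proof.
by move=> f /negP nf; rewrite /invX; case: pselect => // h; case: nf; apply/asboolP.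
Qed.

HB.instance Definition _ := GRing.ComNzRing_hasMulInverse.Build (polyX alpha F)
  mulVX unitXP invX_out.
HB.instance Definition _ := GRing.ComUnitRing_isIntegral.Build (polyX alpha F)
  polyX_integral.

Definition divides_polyX (g f : polyX alpha F) := exists h, f = g * h.

Definition Sset : set (polyX alpha F) :=
  [set f | forall m : monomial alpha, m != mone -> ~ divides_polyX << m >> f].

(* D, as a subring of the quotient field of F[X] *)
Definition domD : set {fraction polyX alpha F} :=
  [set x | exists f s, Sset s /\ x = tofrac f / tofrac s].

End Domain.

Arguments Sset {d W} alpha F.
Arguments domD {d W} alpha F.

Section Subrings.
Context {K : fieldType}.
Implicit Types (R I M P : set K).
Local Open Scope ring_scope.

Definition is_subring R := GRing.subring_closed [pred x : K | x \in R].

Definition is_ideal R I :=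
  [/\ I `<=` R, I 0, forall x y, I x -> I y -> I (x + y) &
      forall a x, R a -> I x -> I (a * x)].

Definition ideal_span R (A : set K) : set K := smallest (is_ideal R) A.

Definition fg_ideal R I :=
  exists A : set K, [/\ finite_set A, A `<=` R & I = ideal_span R A].

Definition Max R : set (set K) :=
  [set M | [/\ is_ideal R M, M <> R &
               forall I, is_ideal R I -> M `<=` I -> I = M \/ I = R]].

Definition ideal_sqr R M : set K :=
  ideal_span R [set x * y | x in M & y in M].

Definition localize R M : set K := [set a / s | a in R & s in R `\` M].

(* The value of v at 0 is irrelevant: v stands for a map K^* -> Z. *)
Definition is_discrete_valuation (v : K -> int) :=
  [/\ forall x y, x != 0 -> y != 0 -> v (x * y) = v x + v y,
      forall x y, x != 0 -> y != 0 -> x + y != 0 ->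
        Num.min (v x) (v y) <= v (x + y) &
      forall n, exists2 x, x != 0 & v x = n].

Definition is_DVR R := exists2 v : K -> int, is_discrete_valuation v &
  R = [set x | x != 0 -> 0 <= v x].

Definition is_almost_dedekind R :=
  is_subring R /\ forall M, Max R M -> is_DVR (localize R M).

Definition CritMax R : set (set K) :=
  [set M | Max R M /\
     forall I, fg_ideal R I -> I `<=` M ->
       exists2 N, Max R N & I `<=` ideal_sqr R N].

(* The intersection of the empty family is K. *)
Definition inter_loc R (C : set (set K)) : set K := \bigcap_(M in C) localize R M.

End Subrings.

Section SPrank.
Context {K : fieldType} {d : Order.disp_t} {W : ordinalsType d} (R : set K).
Implicit Types beta gamma lambda : W.

(* Crit^beta(R), by recursion on beta; see [Crit0], [CritS] and [Crit_limit]. *)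
Definition Crit_step beta (rec : forall gamma, gamma < beta -> set (set K)) :
    set (set K) :=
  [set P | [/\ Max R P,
     forall gamma (h : gamma < beta), beta = osucc gamma ->
       CritMax (inter_loc R (rec gamma h)) (ideal_span (inter_loc R (rec gamma h)) P) &
     is_limit beta -> forall gamma (h : gamma < beta), rec gamma h P]].

Definition Crit : W -> set (set K) :=
  Fix ord_lt_wf (fun _ => set (set K)) Crit_step.

Definition overT beta : set K := inter_loc R (Crit beta).

Lemma CritE beta : Crit beta = Crit_step (fun gamma (_ : gamma < beta) => Crit gamma).
Proof.
rewrite /Crit Fix_eq //= => gamma f g fg.
by congr Crit_step; do 2!apply: functional_extensionality_dep => ?.
Qed.

Lemma Crit0 : Crit \bot = Max R.
Proof.
rewrite CritE; apply/seteqP; split=> P; first by case.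
by split=> //; [move=> gamma; rewrite ltx0|case].
Qed.

Lemma CritS beta :
  Crit (osucc beta) =
  [set P | Max R P /\ CritMax (overT beta) (ideal_span (overT beta) P)].
Proof.
rewrite CritE; apply/seteqP; split=> P /=.
  by case=> MP CP _; split=> //; apply: CP => //; exact: lt_osucc.
case=> MP CP; split=> // [gamma h /osucc_inj <- //|[_]]; case; by exists beta.
Qed.

Lemma Crit_limit lambda : is_limit lambda ->
  Crit lambda = \bigcap_(beta in [set beta | beta < lambda]) Crit beta.
Proof.
move=> llim; rewrite CritE; apply/seteqP; split=> P /=.
  by case=> _ _ /(_ llim) h beta /= /h.
move=> h; split=> [|gamma _ e|_ gamma /h //].
  by rewrite -Crit0; apply: h; rewrite /= lt0x; apply/eqP; case: llim.
by case: llim => _; case; exists gamma.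
Qed.

Definition has_SP_rank beta :=
  Crit beta = set0 /\ forall gamma, gamma < beta -> Crit gamma <> set0.

End SPrank.

(* Main.v *)
From HB Require Import structures.
From mathcomp Require Import all_boot all_order all_algebra fraction.
From mathcomp Require Import finmap boolp classical_sets.
From mathcomp Require Import cardinality fsbigop.
From mathcomp Require Import monalg generic_quotient zify ring.
Require Import Defs.

Set Implicit Arguments.
Unset Strict Implicit.
Unset Printing Implicit Defensive.

Import Order.TTheory GRing.Theory Num.Theory.

Local Open Scope classical_set_scope.
Local Open Scope order_scope.

(** Write [X p] for the vertex [p], viewed as a function on [Uset alpha \bot]
    (its exponents), and call siblings two vertices of the same height whose
    sequences agree above that height.  The supports of the siblings of [p] are
    nested and shrink, as the entry at the height of [p] grows, towards an ideal
    point; every function considered here is near this point a constant multiple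
    of [X p] (this constant is its germ).  The theorem holds because these points,
    one for each class of siblings, are exactly the maximal ideals of D, and the
    height of a point tells when it disappears in the sequence of critical sets.

    Monomials.  Every vertex has a germ at every point ([germ_vertex]), and the
    support of a vertex is, up to a smaller sibling, covered by finitely many
    vertices of smaller height ([sibling_cover]).  By induction on the height,
    a function having a germ at every point and vanishing wherever some
    monomial does is itself a monomial ([monomial_of_local]).  Hence the monomials are closed
    under pointwise minima and differences: any two of them have a gcd
    ([monomial_gcd]).  The germ at [p] is a valuation [mval p] with value 1 at
    [X p]; it vanishes on the vertices lower than [p], and on vertices of the
    height of [p] that are not siblings of [p] ([mval_vertex]).

    Fractions.  Thanks to gcds, each nonzero element of F[X] is the product of a
    unique monomial, its content, and an element of S, where S consists of the
    elements having at each point a term of value 0 ([SsetP]); so S is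
    multiplicative, F[X] being a domain.  Hence [mval p] extends to a discrete
    valuation [pval p] of the quotient field.  Let T_beta be the ring of elements
    with nonnegative value at all points of height at least beta; then D = T_0.
    Up to units of T_beta, its nonzero elements are monomials
    ([height_ring_decomp]).

    Maximal ideals.  The elements of T_beta with positive value at a point of
    height at least beta form a maximal ideal ([point_ideal_max]).  Conversely, if
    [X q] is a vertex of minimal height in a maximal ideal N, then N is the ideal
    of the point of [q]: a monomial in N of value 0 there would be coprime to a
    smaller sibling [X q'] of [X q], so that N would contain [X q / X q'], whose
    vertices are all lower than [q] ([height_ring_Max]).  The localization of D at
    a point is the ring of its valuation ([localize_point]), whence D is almost
    Dedekind, and T_beta is the intersection of the localizations at the points of
    height at least beta.

    Critical ideals.  In T_beta, a point of height beta is not critical, because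
    no valuation of T_beta takes a value above 1 at its vertex ([not_critical]).
    A point of larger height is critical: a monomial with positive value there has
    a factor [X y] of height above beta, and [X y] is divisible by the square of
    a vertex of height at least beta ([critical]).  By induction, Crit^beta(D) is
    the set of points of height at least beta ([Crit_height]), which is empty for
    the first time at beta = alpha. *)

(** * Ordinals *)

Section OrdinalFacts.
Context {d : Order.disp_t} {W : ordinalsType d}.
Implicit Types (beta gamma delta : W) (i j k : nat).

Lemma ord_cases beta : [\/ beta = \bot, is_succ beta | is_limit beta].
Proof.
have [->|/eqP b0] := eqVneq beta \bot; first by constructor 1.
by have [bs|bs] := pselect (is_succ beta); [constructor 2|constructor 3].
Qed.

Lemma limit_osucc beta gamma : is_limit beta -> gamma < beta -> osucc gamma < beta.
Proof.
case=> _ nsucc; rewrite -osucc_le le_eqVlt => /predU1P[e|//].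
by case: nsucc; exists gamma.
Qed.

Lemma succ_gt0 beta : is_succ beta -> \bot < beta.
Proof. by case=> gamma ->; rewrite lt0x osucc_neq0. Qed.

Lemma limit_gt0 beta : is_limit beta -> \bot < beta.
Proof. by case=> b0 _; rewrite lt0x; apply/eqP. Qed.

Lemma oaddD beta i j : oadd beta (i + j) = oadd (oadd beta j) i.
Proof. exact: iterD. Qed.

Lemma ltn_oadd beta i j : (i < j)%N -> oadd beta i < oadd beta j.
Proof.
elim: j => // j IH; rewrite ltnS leq_eqVlt => /predU1P[->|/IH h].
  exact: lt_osucc.
by apply: lt_trans h _; exact: lt_osucc.
Qed.

Lemma oadd_inj beta : injective (oadd beta).
Proof.
move=> i j e; case: (ltngtP i j) => // /(ltn_oadd beta); by rewrite e ltxx.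
Qed.

Lemma natural_oadd beta i : is_natural beta -> is_natural (oadd beta i).
Proof. by case=> n ->; exists (i + n)%N; rewrite oaddD. Qed.

Lemma natural_subP beta gamma : is_natural beta -> is_natural gamma ->
  beta <= gamma -> exists i, gamma = oadd beta i.
Proof.
case=> m -> [n ->]; case: (leqP m n) => [mn _|nm].
  by exists (n - m)%N; rewrite -oaddD subnK.
by rewrite leNgt ltn_oadd.
Qed.

End OrdinalFacts.

(** * Vertices, edges and supports *)

Section Vertices.
Context {d : Order.disp_t} {W : ordinalsType d} (alpha : W).
Implicit Types (beta gamma delta : W) (t : W -> W) (p q z : W * (W -> W)).

Local Notation vertices := (vertices alpha).
Local Notation edge := (edge alpha).
Local Notation I := (set_type (Uset alpha \bot)).
Local Notation X := (exponent alpha).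

Definition set_entry t beta v : W -> W := fun gamma => if gamma == beta then v else t gamma.

Lemma set_entry_gt t beta v gamma : beta < gamma -> set_entry t beta v gamma = t gamma.
Proof. by move=> /gt_eqF; rewrite /set_entry => ->. Qed.

Lemma set_entry_eq t beta v : set_entry t beta v beta = v.
Proof. by rewrite /set_entry eqxx. Qed.

(** All index sequences below arise from one another by changing an entry, and
    possibly lowering the height. *)
Lemma Uset_set_entry beta gamma delta t v :
  Uset alpha beta t -> gamma <= beta -> gamma <= delta -> \bot < delta < alpha ->
  lt_xi alpha v -> (is_succ delta -> is_natural v) ->
  (is_limit delta -> delta = gamma -> v < delta) ->
  Uset alpha gamma (set_entry t delta v).
Proof.
case=> -[tx t0] fin tn tlow tlim gb gd /andP[d0 da] vx vn vl; split.
- split=> [x|x nx]; first by rewrite /set_entry; case: ifP.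
  rewrite /set_entry; case: eqP => [e|_]; last exact: t0.
  by case: nx; rewrite e d0.
- apply: (@sub_finite_set _ _ ([set delta] `|` [set x | t x != \bot])).
    move=> x; rewrite /set_entry /=; case: (x =P delta) => [->|_]; by [left|right].
  by rewrite finite_setU; split=> //; exact: finite_set1.
- move=> x xs; rewrite /set_entry; case: eqP => [e|_]; last exact: tn.
  by apply: vn; rewrite -e; case: xs.
- move=> x xg; rewrite /set_entry lt_eqF; last exact: lt_le_trans gd.
  by apply: tlow; exact: lt_le_trans gb.
- move=> gl; rewrite /set_entry; case: eqP => [e|_].
    by rewrite e; apply: vl; rewrite -?e //; case: gl.
  move: gb; rewrite le_eqVlt => /predU1P[e|gb]; first by rewrite e; apply: tlim; rewrite -e.
  by rewrite tlow //; apply: limit_gt0; case: gl.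
Qed.

(** A sequence in [Uset alpha beta] vanishes below [beta], so that [tau beta] only
    erases its entry at [beta]. *)
Lemma tau_set_entry beta t : Uset alpha beta t -> tau beta t = set_entry t beta \bot.
Proof.
case=> _ _ _ tlow _; apply/funext => x; rewrite /tau /set_entry osucc_le.
by case: ltgtP => // /tlow.
Qed.

Lemma lt_xi0 : lt_xi alpha \bot.
Proof. by left; exists 0%N. Qed.

Lemma vertex_nat p delta : vertices p -> is_succ delta -> is_natural (p.2 delta).
Proof.
move=> [pa [[_ t0] _ tn _ _]] ds; have [da|da] := ltP delta alpha; first exact: tn.
by rewrite t0; [exists 0%N|case/andP => _; rewrite ltNge da].
Qed.

Lemma vertex_low p delta : vertices p -> delta < p.1 -> p.2 delta = \bot.
Proof. by case=> _ [_ _ _ h _]; exact: h. Qed.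

Lemma vertex_lim p : vertices p -> is_limit p.1 -> p.2 p.1 < p.1.
Proof. by case=> pa [_ _ _ _ h] pl; exact: h. Qed.

Lemma vertex_set_entry p gamma delta v : vertices p ->
  gamma <= p.1 -> gamma <= delta -> \bot < delta < alpha ->
  lt_xi alpha v -> (is_succ delta -> is_natural v) ->
  (is_limit delta -> delta = gamma -> v < delta) ->
  vertices (gamma, set_entry p.2 delta v).
Proof.
move=> [pa pU] gp gd da vx vn vl; split; first exact: le_lt_trans pa.
exact: Uset_set_entry pU _ _ _ _ _ _.
Qed.

Lemma edge_succ p gamma i : vertices p -> p.1 = osucc gamma -> (0 < i)%N ->
  edge p (gamma, set_entry p.2 p.1 (oadd (p.2 p.1) i)).
Proof.
move=> pV e i0; split=> //; left; exists gamma, i; split=> //.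
by congr pair; apply/funext => x; rewrite /set_entry /seq_add; case: eqP => // ->.
Qed.

Lemma edge_limit p gamma : vertices p -> is_limit p.1 -> is_succ gamma ->
  p.2 p.1 < gamma < p.1 -> edge p (gamma, set_entry p.2 p.1 \bot).
Proof.
move=> pV pl gs /andP[gt gp]; split=> //; right; split=> //; exists gamma.
by split=> //; rewrite tau_set_entry //; case: pV.
Qed.

Variant edge_spec p q : Prop :=
| EdgeSucc gamma i of p.1 = osucc gamma & (0 < i)%N &
    q = (gamma, set_entry p.2 p.1 (oadd (p.2 p.1) i))
| EdgeLimit gamma of is_limit p.1 & is_succ gamma & p.2 p.1 < gamma < p.1 &
    q = (gamma, set_entry p.2 p.1 \bot).

Lemma edgeP p q : edge p q -> edge_spec p q.
Proof.
case=> pV [[gamma [k [e k0 ->]]]|[pl [gamma [[gp gs] tg ->]]]].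
  apply: (EdgeSucc e k0); congr pair; apply/funext => x; rewrite /set_entry /seq_add.
  by case: eqP => // ->.
apply: (@EdgeLimit _ _ gamma) => //; first by rewrite tg.
by rewrite tau_set_entry //; case: pV.
Qed.

Lemma edge_vertex p q : edge p q -> vertices q.
Proof.
move=> pq; have pV : vertices p by case: pq.
have pa : p.1 < alpha by case: pV.
case: (edgeP pq) => [gamma i e i0 ->|gamma pl gs /andP[tg gp] ->].
  have pn : is_natural (p.2 p.1) by apply: vertex_nat => //; exists gamma.
  apply: vertex_set_entry => //.
  - by rewrite e ltW // lt_osucc.
  - by rewrite e ltW // lt_osucc.
  - by rewrite pa andbT e lt0x osucc_neq0.
  - by left; exact: natural_oadd.
  - by move=> _; exact: natural_oadd.
  - by case=> _ []; exists gamma.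
apply: vertex_set_entry => //; try exact: ltW.
- by rewrite pa andbT limit_gt0.
- exact: lt_xi0.
- by move=> _; exists 0%N.
- by move=> ? e; rewrite -e ltxx in gp.
Qed.

Lemma edge_above p q delta : edge p q -> p.1 < delta -> q.2 delta = p.2 delta.
Proof. by move=> /edgeP[gamma i _ _ ->|gamma _ _ _ ->] /= h; rewrite set_entry_gt. Qed.

Lemma exists_child p r : p.1 != \bot -> X p r != 0%N ->
  exists2 q, edge p q & X q r != 0%N.
Proof.
move=> p0; rewrite exponent_edge //; apply: contraNP => nq.
rewrite fsbig1 // => q /= pq; apply/eqP; rewrite muln_eq0 /=.
by apply: contrapT => /negP h; apply: nq; exists q.
Qed.

Lemma support0 p r : p.1 = \bot -> X p r != 0%N -> val r = p.2.
Proof. by case: p => _ t /= ->; rewrite exponent0 eqb0 negbK => /eqP. Qed.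

Lemma height_ind (P : W * (W -> W) -> Prop) :
  (forall p, (forall q, q.1 < p.1 -> P q) -> P p) -> forall p, P p.
Proof.
move=> H [b t]; elim/(well_founded_ind (@ord_lt_wf d W)): b t => b IH t.
by apply: H => -[c s] /= cb; exact: IH.
Qed.

(** An edge only changes the entry at the height of its source, hence a path from
    [p] down to an indeterminate leaves the entries above [p] unchanged. *)
Lemma support_above p r delta : X p r != 0%N -> p.1 < delta ->
  val r delta = p.2 delta.
Proof.
elim/height_ind: p => p IH Xp pd.
have [p0|p0] := eqVneq p.1 \bot; first by rewrite (support0 p0).
have [q pq Xq] := exists_child p0 Xp; have qp := edge_height pq.
by rewrite -(edge_above pq pd); apply: IH => //; exact: lt_trans pd.
Qed.

(** The step from a successor height increases the entry at that height, and the
    later steps do not touch it. *)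
Lemma support_succ p r : is_succ p.1 -> X p r != 0%N -> p.2 p.1 < val r p.1.
Proof.
move=> ps Xp; have [|q pq Xq] := exists_child _ Xp.
  by have := succ_gt0 ps; rewrite lt0x.
case: (edgeP pq) Xq => [gamma i e i0 ->|gamma [_ []] //] Xq.
rewrite (support_above Xq) /=; first by rewrite set_entry_eq; exact: (ltn_oadd _ i0).
by rewrite e lt_osucc.
Qed.

(** From a limit height one jumps to a successor height [gamma]; the next step then
    makes the entry at [gamma] nonzero. *)
Lemma support_limit p r : is_limit p.1 -> X p r != 0%N ->
  exists gamma, [/\ is_succ gamma, p.2 p.1 < gamma < p.1,
    X (gamma, set_entry p.2 p.1 \bot) r != 0%N & val r gamma != \bot].
Proof.
move=> pl Xp; have [|q pq Xq] := exists_child _ Xp.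
  by have := limit_gt0 pl; rewrite lt0x.
case: (edgeP pq) Xq => [gamma i e|gamma _ gs tg ->] Xq.
  by case: pl => _ []; exists gamma.
have /(_ gs) /= h := support_succ _ Xq.
by exists gamma; split=> //; rewrite -lt0x; apply: le_lt_trans h; exact: le0x.
Qed.

(** The child through which [r] is reached can be read off from [r]: by its entry
    at the height of [p] in the successor case, and by its last nonzero entry below
    the height of [p] in the limit case. *)
Lemma child_unique p q q' r : edge p q -> edge p q' ->
  X q r != 0%N -> X q' r != 0%N -> q = q'.
Proof.
move=> pq pq'; have pV : vertices p by case: pq.
case: (edgeP pq) => [gamma i e i0 ->|gamma pl gs /andP[tg gp] ->];
  case: (edgeP pq') => [gamma' i' e' i0' ->|gamma' pl' gs' /andP[tg' gp'] ->] Xq Xq'.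
- have g : gamma = gamma' by apply: osucc_inj; rewrite -e.
  rewrite -g in Xq' *.
  have gp : gamma < p.1 by rewrite e lt_osucc.
  have := support_above Xq gp; rewrite (support_above Xq' gp) /= !set_entry_eq.
  by move/oadd_inj ->.
- by case: pl' => _ []; exists gamma.
- by case: pl => _ []; exists gamma'.
- wlog gg' : gamma gamma' gs gs' tg tg' gp gp' Xq Xq' {pq pq'} / gamma < gamma'.
    by move=> h; case: (ltgtP gamma gamma') => [|?|->//]; [exact: h|rewrite (h gamma' gamma)].
  have /(_ gs') /= := support_succ _ Xq'.
  by rewrite (support_above Xq) // ltxx.
Qed.

Lemma exponent_child p q r : edge p q -> X q r != 0%N -> X p r = (2 * X q r)%N.
Proof.
move=> pq Xq; rewrite exponent_edge; last first.
  by rewrite -lt0x; apply: le_lt_trans (edge_height pq); exact: le0x.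
rewrite -(@fsbig_widen _ _ _ addn [set q]) ?fsbig_set1 //.
  by move=> _ ->.
move=> q' [/= pq' qq']; apply/eqP; rewrite muln_eq0 /=; apply/negPn/negP => Xq'.
by apply: qq'; rewrite (child_unique pq pq' Xq Xq').
Qed.

Lemma exponent_le_child p q r : edge p q -> (2 * X q r <= X p r)%N.
Proof.
by move=> pq; have [->|/(exponent_child pq) ->] := eqVneq (X q r) 0%N; rewrite ?muln0.
Qed.

End Vertices.

(** * Vertices with a common limit point *)

Lemma finite_set_max {d : Order.disp_t} {T : orderType d} (A : set T) x :
  finite_set A -> A x -> exists2 m, A m & forall y, A y -> y <= m.
Proof.
case/finite_seqP => s -> {A}; elim: s x => [x|y s IH x _]; first by rewrite /= in_nil.
have [[z zs]|ns] := pselect (exists z, z \in s); last first.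
  exists y => [|z] /=; rewrite !inE ?eqxx // => /predU1P[->//|zs].
  by case: ns; exists z.
have [m ms mP] := IH z zs.
have [ym|/ltW my] := leP y m.
  exists m => [|w] /=; first by rewrite inE ms orbT.
  by rewrite inE => /predU1P[->//|/mP].
exists y => [|w] /=; first by rewrite inE eqxx.
by rewrite inE => /predU1P[->//|/mP h]; exact: le_trans my.
Qed.

Section Siblings.
Context {d : Order.disp_t} {W : ordinalsType d} (alpha : W).
Implicit Types (beta gamma delta : W) (t : W -> W) (p q z : W * (W -> W)).

Local Notation vertices := (vertices alpha).
Local Notation edge := (edge alpha).
Local Notation I := (set_type (Uset alpha \bot)).
Local Notation X := (exponent alpha).

(** Siblings shrink towards the same point; a point is represented by any of the
    vertices in its class. *)
Definition sibling p q := [/\ vertices p, vertices q, p.1 = q.1 &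
  forall delta, p.1 < delta -> p.2 delta = q.2 delta].

Lemma sibling_refl p : vertices p -> sibling p p.
Proof. by []. Qed.

Lemma sibling_sym p q : sibling p q -> sibling q p.
Proof.
by case=> pV qV e h; split=> // delta; rewrite -e => /h.
Qed.

Lemma sibling_trans p q z : sibling p q -> sibling q z -> sibling p z.
Proof.
move=> [pV qV e h] [_ zV e' h']; split=> //; first by rewrite e.
by move=> delta pd; rewrite h // h' // -e.
Qed.

Lemma sibling_set_entry p q v : sibling p q ->
  set_entry p.2 p.1 v = set_entry q.2 q.1 v.
Proof.
move=> [pV qV e h]; apply/funext => x; rewrite /set_entry e.
case: ltgtP => // xp; last by rewrite h // e.
by rewrite !(@vertex_low _ _ alpha) // e.
Qed.

Lemma sibling0 p q : sibling p q -> p.1 = \bot -> p = q.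
Proof.
case: p q => [b t] [b' t'] [/= pV qV e h] b0; rewrite -{}e in qV *.
move: h pV qV; rewrite {}b0 => h [_ [[_ /= t0] _ _ _ _]] [_ [[_ /= t0'] _ _ _ _]].
congr pair; apply/funext => x; have [->|] := eqVneq x \bot.
  by rewrite t0 ?t0' //= ltxx.
by rewrite -lt0x => /h.
Qed.

(** Of two siblings, the one with the larger entry has its children among those of
    the other, hence is the restriction of the other to a smaller support. *)
Lemma sibling_exponent p q r : sibling p q -> p.2 p.1 <= q.2 p.1 ->
  X q r != 0%N -> X p r = X q r.
Proof.
move=> pq; have [pV qV e h] := pq; case: (ord_cases p.1) => [p0|ps|pl] tle Xq.
- by rewrite (sibling0 pq).
- have qs : is_succ q.1 by rewrite -e.
  have [i ei] : exists i, q.2 p.1 = oadd (p.2 p.1) i.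
    by apply: natural_subP => //; exact: (@vertex_nat _ _ alpha).
  have [|s qs' Xs] := exists_child _ Xq; first by rewrite -lt0x succ_gt0.
  rewrite (exponent_child qs' Xs).
  case: (edgeP qs') => [gamma j ej j0 es|gamma [_ []] //].
  suff ps' : edge p s by exact: exponent_child.
  have -> : s = (gamma, set_entry p.2 p.1 (oadd (p.2 p.1) (j + i))).
    by rewrite es (sibling_set_entry _ pq) // oaddD -ei e.
  by apply: edge_succ; rewrite ?e // addn_gt0 j0.
- have [|s qs' Xs] := exists_child _ Xq; first by rewrite -lt0x -e limit_gt0.
  rewrite (exponent_child qs' Xs).
  case: (edgeP qs') => [gamma j ej _ _|gamma ql gs /andP[tg gp] es].
    by case: pl => _ []; exists gamma; rewrite e.
  suff ps' : edge p s by exact: exponent_child.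
  rewrite es -(sibling_set_entry _ pq) //; apply: edge_limit => //.
  by rewrite e gp andbT -e; apply: le_lt_trans tle _; rewrite e.
Qed.

(** Above a given [beta] there is always a successor ordinal to jump to from a
    limit height. *)
Lemma exists_edge p beta : vertices p -> beta < p.1 ->
  exists2 q, edge p q & beta <= q.1.
Proof.
move=> pV bp; case: (ord_cases p.1) => [p0|[gamma e]|pl].
- by rewrite p0 ltx0 in bp.
- exists (gamma, set_entry p.2 p.1 (oadd (p.2 p.1) 1)); first exact: edge_succ.
  by rewrite /= -lt_osuccr -e.
- have tp := vertex_lim pV pl.
  exists (osucc (Order.max beta (p.2 p.1)), set_entry p.2 p.1 \bot).
    apply: edge_limit => //; first by eexists; reflexivity.
    rewrite lt_osuccr le_max lexx orbT /=; apply: limit_osucc => //.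
    by rewrite gt_max bp.
  by rewrite /= ltW // lt_osuccr le_max lexx.
Qed.

Lemma exponent_nonempty p : vertices p -> exists r, X p r != 0%N.
Proof.
elim/(@height_ind d W): p => p IH pV.
have [p0|] := eqVneq p.1 \bot.
  have pU : Uset alpha \bot p.2 by case: pV; rewrite p0.
  exists (SigSub (mem_set pU)); case: p pV p0 pU {IH} => b t /= _ -> tU.
  by rewrite exponent0 /= eqxx.
rewrite -lt0x => /(exists_edge pV)[q pq _].
have [r Xr] := IH q (edge_height pq) (edge_vertex pq).
by exists r; rewrite (exponent_child pq Xr) muln_eq0.
Qed.

(** Infinitely many children of a limit vertex may start below [eps].  When [eps] is
    itself a limit, they are all children of a single vertex of height [eps]; a
    finite descent from [eps] therefore covers them. *)
Lemma limit_cover p delta eps : vertices p -> is_limit p.1 -> eps < p.1 ->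
  exists2 L : seq (W * (W -> W)),
    (forall z, z \in L -> vertices z /\ z.1 < p.1) &
    forall gamma r, is_succ gamma -> delta < gamma <= eps ->
      X (gamma, set_entry p.2 p.1 \bot) r != 0%N -> exists2 z, z \in L & X z r != 0%N.
Proof.
move=> pV pl; have pa : p.1 < alpha by case: pV.
have low beta : beta < p.1 -> is_succ beta -> vertices (beta, set_entry p.2 p.1 \bot).
  move=> bp bs; apply: vertex_set_entry => //; try exact: ltW.
  - by rewrite limit_gt0.
  - exact: lt_xi0.
  - by move=> _; exists 0%N.
  - by move=> _ e; rewrite e ltxx in bp.
have pV' : vertices (p.1, set_entry p.2 p.1 \bot).
  apply: vertex_set_entry => //; rewrite ?limit_gt0 //; first exact: lt_xi0.
  by move=> _; exists 0%N.
elim/(well_founded_ind (@ord_lt_wf d W)): eps => eps IH ep.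
case: (ord_cases eps) => [->|[eps' e]|el].
- exists [::] => // gamma r _; rewrite lex0 => /andP[dg /eqP g0].
  by rewrite g0 ltx0 in dg.
- have ee : eps' < eps by rewrite e lt_osucc.
  have [L LV LP] := IH _ ee (lt_trans ee ep).
  exists ((eps, set_entry p.2 p.1 \bot) :: L).
    move=> z; rewrite inE => /predU1P[->|/LV //]; split=> //.
    by apply: low => //; exists eps'.
  move=> gamma r gs /andP[dg]; rewrite le_eqVlt => /predU1P[->|ge] Xr.
    by exists (eps, set_entry p.2 p.1 \bot); rewrite ?inE ?eqxx.
  have [|z zL Xz] := LP gamma r gs _ Xr; first by rewrite dg -lt_osuccr -e.
  by exists z => //; rewrite inE zL orbT.
- have [ed|de] := leP eps delta.
    exists [::] => // gamma r _ /andP[h1 h2].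
    by have := lt_le_trans h1 (le_trans h2 ed); rewrite ltxx.
  pose z := (eps, set_entry (set_entry p.2 p.1 \bot) eps delta).
  have zV : vertices z.
    apply: (vertex_set_entry pV') => //=; try exact: ltW.
    - by rewrite limit_gt0 // (lt_trans ep).
    - by right; apply: lt_trans (lt_trans ep pa).
    - by move=> es; case: el.
  exists [:: z]; first by move=> y; rewrite inE => /eqP ->.
  move=> gamma r gs /andP[dg]; rewrite le_eqVlt => /predU1P[ge|ge] Xr.
    by case: el => _ []; rewrite -ge.
  exists z; first by rewrite inE.
  have zg : edge z (gamma, set_entry z.2 z.1 \bot).
    by apply: edge_limit => //=; rewrite set_entry_eq dg.
  have e : set_entry z.2 z.1 \bot = set_entry p.2 p.1 \bot.
    apply/funext => x; rewrite /z /= /set_entry; case: (x =P eps) => // ->.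
    by case: eqP => // _; rewrite (vertex_low pV).
  by rewrite e in zg; rewrite (exponent_child zg Xr) muln_eq0.
Qed.

(** This is the compactness of the support of [p]: what a neighborhood of its point
    leaves over is covered by finitely many lower vertices. *)
Lemma sibling_cover p q : sibling p q ->
  exists2 L : seq (W * (W -> W)),
    (forall z, z \in L -> vertices z /\ z.1 < p.1) &
    forall r, X p r != 0%N -> X q r != 0%N \/ exists2 z, z \in L & X z r != 0%N.
Proof.
move=> pq; have [pV qV e h] := pq.
have [qp|pq'] := leP (q.2 p.1) (p.2 p.1).
  exists [::] => // r Xp; left; rewrite (sibling_exponent (sibling_sym pq) _ Xp) //.
  by rewrite -e.
case: (ord_cases p.1) => [p0|ps|pl].
- by exists [::] => // r; left; rewrite -(sibling0 pq).
- have [i ei] : exists i, q.2 p.1 = oadd (p.2 p.1) i.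
    by apply: natural_subP; rewrite ?ltW //; exact: (@vertex_nat _ _ alpha).
  have [gamma eg] := ps.
  pose L := [seq (gamma, set_entry p.2 p.1 (oadd (p.2 p.1) j.+1)) | j <- iota 0 i].
  have gp : gamma < p.1 by rewrite eg lt_osucc.
  exists L => [z /mapP[j _ ->]|r Xp].
    by split=> //; apply: edge_vertex (edge_succ pV eg _).
  have [|s ps' Xs] := exists_child _ Xp; first by rewrite -lt0x succ_gt0.
  case: (edgeP ps') => [gamma' j ej j0 es|gamma' [_ []] //].
  have gg : gamma' = gamma by apply: osucc_inj; rewrite -ej.
  rewrite {}gg in es; have [ji|ij] := leqP j i.
    right; exists s => //; rewrite es; apply/mapP; exists j.-1.
      by rewrite mem_iota; case: j j0 ji {ej es}.
    by rewrite prednK.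
  left; suff qs : edge q s by rewrite (exponent_child qs Xs) muln_eq0.
  have -> : s = (gamma, set_entry q.2 q.1 (oadd (q.2 q.1) (j - i))).
    by rewrite es (sibling_set_entry _ pq) // -e ei -oaddD subnK // ltnW.
  by apply: edge_succ; rewrite -?e // subn_gt0.
- have [|L LV LP] := @limit_cover p (p.2 p.1) (q.2 p.1) pV pl.
    by have := vertex_lim qV; rewrite -e => /(_ pl).
  exists L => // r Xp; have [gamma [gs /andP[tg gp] Xg _]] := support_limit pl Xp.
  have [ge|eg] := leP gamma (q.2 p.1).
    by right; apply: (LP gamma) => //; rewrite tg.
  left; suff qs : edge q (gamma, set_entry p.2 p.1 \bot).
    by rewrite (exponent_child qs Xg) muln_eq0.
  by rewrite (sibling_set_entry _ pq) //; apply: edge_limit; rewrite -?e ?eg.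
Qed.

End Siblings.

(** * Germs of vertices *)

Section Germs.
Context {d : Order.disp_t} {W : ordinalsType d} (alpha : W).
Implicit Types (beta gamma delta : W) (t : W -> W) (p q z : W * (W -> W)).

Local Notation vertices := (vertices alpha).
Local Notation edge := (edge alpha).
Local Notation I := (set_type (Uset alpha \bot)).
Local Notation X := (exponent alpha).
Local Notation sibling := (sibling alpha).

Lemma sibling_change p v : vertices p -> \bot < p.1 -> lt_xi alpha v ->
  (is_succ p.1 -> is_natural v) -> (is_limit p.1 -> v < p.1) ->
  sibling p (p.1, set_entry p.2 p.1 v).
Proof.
move=> pV p0 vx vn vl; split=> // [|delta pd]; last by rewrite /= set_entry_gt.
by apply: vertex_set_entry => //; [rewrite p0; case: pV|move=> /vl].
Qed.

(** A point of larger height stays away from the support of [q], since the entry of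
    a sibling at the height of [p] can be taken beyond all nonzero entries of [q]
    below that height. *)
Lemma sibling_disjoint_lower p q : vertices p -> vertices q -> q.1 < p.1 ->
  exists2 p', sibling p p' & forall r, X p' r != 0%N -> X q r = 0%N.
Proof.
move=> pV qV qp; have pa : p.1 < alpha by case: pV.
have p0 : \bot < p.1 by apply: le_lt_trans qp; exact: le0x.
case: (ord_cases p.1) => [e|ps|pl].
- by rewrite e ltxx in p0.
- have qn : is_natural (q.2 p.1) by exact: (@vertex_nat _ _ alpha).
  exists (p.1, set_entry p.2 p.1 (q.2 p.1)).
    by apply: sibling_change => //; [left|case=> _ []].
  move=> r Xp; apply: contrapT => /eqP Xq.
  have /(_ ps) /= := support_succ _ Xp.
  by rewrite set_entry_eq (support_above Xq) // ltxx.
- (* Any eps bounding q.1 and the support of q.2 below the height of p will do. *)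
  have [eps ep [qe eP]] : exists2 eps, eps < p.1 & q.1 <= eps /\
      forall delta, delta < p.1 -> q.2 delta != \bot -> delta <= eps.
    pose A : set W := [set q.1] `|` [set delta | delta < p.1 /\ q.2 delta != \bot].
    have [||m mA mP] := @finite_set_max _ W A q.1; last first.
      exists m; first by case: mA => [->//|[]].
      by split=> [|delta dp qd]; apply: mP; [left|right].
    - by left.
    - rewrite finite_setU; split; first exact: finite_set1.
      by have [_ [_ fin _ _ _]] := qV; apply: sub_finite_set fin => x [].
  exists (p.1, set_entry p.2 p.1 eps).
    apply: sibling_change => //; first by right; exact: lt_trans pa.
    by case: pl => _ ns /ns.
  move=> r Xp; apply: contrapT => /eqP Xq.
  have [gamma /= [gs]] := support_limit (pl : is_limit (_, _).1) Xp.
  rewrite set_entry_eq => /andP[eg gp] Xg rg.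
  have qg : q.1 < gamma by exact: le_lt_trans eg.
  by move: rg; rewrite (support_above Xq qg) => /(eP _ gp); rewrite leNgt eg.
Qed.

(** The jump from a limit height to [gamma] erases all entries in between. *)
Lemma support_limit_zero p r gamma delta : vertices p ->
  X (gamma, set_entry p.2 p.1 \bot) r != 0%N -> gamma < delta <= p.1 ->
  val r delta = \bot.
Proof.
move=> pV Xg /andP[gd dp]; rewrite (support_above Xg) //= /set_entry.
case: eqP => // /eqP dp'; apply: (vertex_low pV).
by rewrite lt_neqAle dp' dp.
Qed.

Let has_germ p q := exists2 p', sibling p p' &
  exists c, forall r, X p' r != 0%N -> X q r = (c * X p' r)%N.

(** At most one child of [q] meets the support of a small sibling of [p], because
    the entries of [p] above its own height determine it; the germ of [q] is then
    twice that of this child.  The exception is a limit vertex [q] none of whose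
    children above [p] matter: if it does not vanish near [p], it agrees there with a
    sibling of [p] or with twice one, according to the height of [p] being a limit
    or a successor. *)
Lemma germ_upper p q : vertices p -> vertices q -> p.1 < q.1 ->
  (forall z, edge q z -> has_germ p z) -> has_germ p q.
Proof.
move=> pV qV pq IH.
have germ0 : (forall r, X p r != 0%N -> X q r = 0%N) -> has_germ p q.
  by move=> h; exists p => //; exists 0%N.
have germ_child z : edge q z ->
    (forall p' r, sibling p p' -> X p' r != 0%N -> X q r != 0%N -> X z r != 0%N) ->
    has_germ p q.
  move=> qz h; have [p' pp' [c cP]] := IH z qz.
  exists p' => //; exists (2 * c)%N => r Xp.
  have [Xz|Xz] := eqVneq (X z r) 0%N; last by rewrite (exponent_child qz Xz) cP // mulnA.
  have /eqP := cP r Xp; rewrite Xz eq_sym muln_eq0 (negPf Xp) orbF => /eqP ->.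
  by apply/eqP/negPn/negP => /(h p' r pp' Xp); rewrite Xz.
have above p' r delta : sibling p p' -> X p' r != 0%N -> p.1 < delta ->
    val r delta = p.2 delta.
  by move=> [_ _ e h] Xp pd; rewrite (support_above Xp) -?e // h.
case: (ord_cases q.1) => [q0|qs|ql]; first by rewrite q0 ltx0 in pq.
- have [gamma eg] := qs.
  have [pq2|qp2] := leP (p.2 q.1) (q.2 q.1).
    apply: germ0 => r Xp; apply: contrapT => /eqP Xq.
    have := support_succ qs Xq.
    by rewrite (above p) // ltNge pq2.
  have [i ei] : exists i, p.2 q.1 = oadd (q.2 q.1) i.
    by apply: natural_subP; rewrite ?ltW //; exact: (@vertex_nat _ _ alpha).
  have i0 : (0 < i)%N by case: i ei qp2 => // ->; rewrite ltxx.
  apply: (germ_child _ (edge_succ qV eg i0)) => p' r pp' Xp Xq.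
  have [|z qz Xz] := exists_child _ Xq; first by rewrite -lt0x succ_gt0.
  case: (edgeP qz) => [gamma' j ej j0 ez|gamma' [_ []] //].
  have gg : gamma' = gamma by apply: osucc_inj; rewrite -ej.
  rewrite {}gg in ez.
  suff -> : i = j by rewrite -ez.
  apply: (@oadd_inj _ _ (q.2 q.1)); rewrite -ei -(above p' r) //.
  by rewrite (support_above Xz) ez /= ?set_entry_eq // eg lt_osucc.
- have zero r delta gamma : X (gamma, set_entry q.2 q.1 \bot) r != 0%N ->
      gamma < delta <= q.1 -> val r delta = \bot by exact: support_limit_zero.
  have [[gamma0 /andP[pg gq] pg0]|none] :=
      pselect (exists2 gamma, p.1 < gamma < q.1 & p.2 gamma != \bot).
    (* Only the child at the last nonzero entry of p below q.1 can matter. *)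
    have [||g0 [/andP[pg0' g0q] pg0n] g0max] := @finite_set_max _ W
        [set gamma | p.1 < gamma < q.1 /\ p.2 gamma != \bot] gamma0.
    + by have [_ [_ fin _ _ _]] := pV; apply: sub_finite_set fin => x [].
    + by split; rewrite ?pg.
    have only p' r : sibling p p' -> X p' r != 0%N -> X q r != 0%N ->
        [/\ is_succ g0, q.2 q.1 < g0 & X (g0, set_entry q.2 q.1 \bot) r != 0%N].
      move=> pp' Xp Xq; have [gamma [gs /andP[tg gq'] Xg rg]] := support_limit ql Xq.
      suff e : gamma = g0 by rewrite -e.
      apply/eqP; rewrite eq_le; apply/andP; split; rewrite leNgt; apply/negP => lt.
        have pgm : p.1 < gamma by exact: lt_trans lt.
        move: rg; rewrite (above p') // => rg.
        have : gamma <= g0 by apply: g0max; rewrite /= pgm.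
        by rewrite leNgt lt.
      have := zero r g0 _ Xg; rewrite lt ltW // => /(_ isT).
      by rewrite (above p') // => e; rewrite e eqxx in pg0n.
    have [[g0s qg0]|ng] := pselect (is_succ g0 /\ q.2 q.1 < g0).
      apply: (germ_child (g0, set_entry q.2 q.1 \bot)).
        by apply: edge_limit => //; rewrite qg0.
      by move=> p' r pp' Xp Xq; have [] := only p' r pp' Xp Xq.
    apply: germ0 => r Xp; apply: contrapT => /eqP Xq.
    by apply: ng; have [] := only p r _ Xp Xq.
  have pzero delta : p.1 < delta < q.1 -> p.2 delta = \bot.
    move=> h; apply: contrapT => /eqP pd; apply: none; by exists delta.
  have low p' r gamma : sibling p p' -> X p' r != 0%N -> gamma < q.1 ->
      val r gamma != \bot -> gamma <= p.1.
    move=> pp' Xp gq rg; rewrite leNgt; apply/negP => pg.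
    by move: rg; rewrite (above p') // pzero ?pg // eqxx.
  have [agree|/existsNP[delta /not_implyP[pd nd]]] :=
      pselect (forall delta, p.1 < delta ->
        p.2 delta = set_entry q.2 q.1 \bot delta); last first.
    apply: germ0 => r Xp; apply: contrapT => /eqP Xq; apply: nd.
    have [gamma [gs /andP[tg gq] Xg rg]] := support_limit ql Xq.
    rewrite -(above p r) // (support_above Xg) //=.
    by apply: le_lt_trans pd; exact: (low p r).
  have [pt|tp] := leP p.1 (q.2 q.1).
    apply: germ0 => r Xp; apply: contrapT => /eqP Xq.
    have [gamma [gs /andP[tg gq] Xg rg]] := support_limit ql Xq.
    have gp : gamma <= p.1 by exact: (low p r).
    by have := lt_le_trans tg (le_trans gp pt); rewrite ltxx.
  have p0 : \bot < p.1 by apply: le_lt_trans tp; exact: le0x.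
  have entry0 delta : delta <= q.1 -> set_entry q.2 q.1 \bot delta = \bot.
    rewrite le_eqVlt /set_entry => /predU1P[->|dq]; first by rewrite eqxx.
    by rewrite lt_eqF // (vertex_low qV).
  case: (ord_cases p.1) => [e|ps|pl]; first by rewrite e ltxx in p0.
    have qz : edge q (p.1, set_entry q.2 q.1 \bot) by apply: edge_limit; rewrite ?tp.
    exists (p.1, set_entry q.2 q.1 \bot); first by split=> //; exact: edge_vertex qz.
    by exists 2%N => r; exact: exponent_child.
  (* With the entry of q at its own height, the sibling of p has exactly those
     children of q that lie below p.1. *)
  have pp' : sibling p (p.1, set_entry p.2 p.1 (q.2 q.1)).
    apply: sibling_change => //; last by case: pl => _ ns /ns.
    by right; apply: (lt_trans tp); case: pV.
  exists (p.1, set_entry p.2 p.1 (q.2 q.1)) => //; exists 1%N => r Xp; rewrite mul1n.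
  have [gamma /= [gs /andP[tg gp] Xg _]] := support_limit (pl : is_limit (_, _).1) Xp.
  rewrite set_entry_eq in tg.
  have p'V : vertices (p.1, set_entry p.2 p.1 (q.2 q.1)) by case: pp'.
  have p'g : edge (p.1, set_entry p.2 p.1 (q.2 q.1))
      (gamma, set_entry (set_entry p.2 p.1 (q.2 q.1)) p.1 \bot).
    by apply: edge_limit => //=; rewrite set_entry_eq tg.
  have qg : edge q (gamma, set_entry q.2 q.1 \bot).
    by apply: edge_limit => //; rewrite tg (lt_trans gp).
  have e : set_entry (set_entry p.2 p.1 (q.2 q.1)) p.1 \bot = set_entry q.2 q.1 \bot.
    apply/funext => x; have [xp|px] := leP x p.1; last by rewrite -agree // !set_entry_gt.
    rewrite entry0 ?(le_trans xp) ?ltW //; move: xp; rewrite le_eqVlt => /predU1P[->|xp].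
      by rewrite set_entry_eq.
    by rewrite /set_entry lt_eqF // (vertex_low pV).
  rewrite e in p'g Xg.
  by rewrite (exponent_child p'g Xg) (exponent_child qg Xg).
Qed.

Lemma germ_vertex p q : vertices p -> vertices q ->
  exists p' c, [/\ sibling p p',
    forall r, X p' r != 0%N -> X q r = (c * X p' r)%N &
    q.1 <= p.1 -> c = `[< sibling p q >]].
Proof.
move=> pV; elim/(@height_ind d W): q => q IH qV.
have [qp|pq|e] := ltgtP q.1 p.1.
- have [p' pp' h] := sibling_disjoint_lower pV qV qp.
  exists p', 0%N; split=> // _.
  by rewrite asboolF // => -[_ _ e _]; rewrite e ltxx in qp.
- have [|p' pp' [c cP]] := germ_upper pV qV pq; last by exists p', c.
  move=> z qz; have [p' [c [pp' cP _]]] := IH z (edge_height qz) (edge_vertex qz).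
  by exists p' => //; exists c.
- have [pq|npq] := pselect (sibling p q).
    exists q, 1%N; split=> // [r _|_]; first by rewrite mul1n.
    by rewrite asboolT.
  exists p, 0%N; split=> // [r Xp|_]; last by rewrite asboolF.
  apply: contrapT => /eqP Xq; apply: npq; split=> // delta pd.
  by rewrite -(support_above Xp pd) -(support_above Xq) // e.
Qed.

End Germs.

(** * The monoid of monomials and its valuations *)

Section Monomials.
Context {d : Order.disp_t} {W : ordinalsType d} (alpha : W).
Implicit Types (beta gamma delta : W) (t : W -> W) (p q z : W * (W -> W)).

Local Notation vertices := (vertices alpha).
Local Notation edge := (edge alpha).
Local Notation I := (set_type (Uset alpha \bot)).
Local Notation X := (exponent alpha).
Local Notation sibling := (sibling alpha).
Local Notation is_monomial := (is_monomial alpha).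
Implicit Types (f g : I -> nat) (m n k : monomial alpha).

(** The value [c] is normalized so that [X p] has germ 1 at its own point. *)
Definition germ p f (c : nat) := exists2 p', sibling p p' &
  forall r, X p' r != 0%N -> f r = (c * X p' r)%N.

Definition is_local f := forall p, vertices p -> exists c, germ p f c.

Lemma germ_common p f g a b : germ p f a -> germ p g b ->
  exists2 p', sibling p p' & forall r, X p' r != 0%N ->
    f r = (a * X p' r)%N /\ g r = (b * X p' r)%N.
Proof.
move=> [p1 pp1 h1] [p2 pp2 h2].
wlog le12 : p1 p2 a b f g pp1 h1 pp2 h2 / p1.2 p1.1 <= p2.2 p1.1.
  have [le12 /(_ p1 p2 a b f g)|lt21 /(_ p2 p1 b a g f)] := leP (p1.2 p1.1) (p2.2 p1.1).
    exact.
  have e : p1.1 = p2.1 by case: pp1 pp2 => _ _ <- _ [_ _ <- _].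
  case=> // [|p' pp' h]; first by rewrite -e ltW.
  by exists p' => // r /h[].
exists p2 => // r X2; split; last exact: h2.
have s12 : sibling p1 p2 by apply: sibling_trans (sibling_sym pp1) pp2.
have X12 := sibling_exponent s12 le12 X2.
by rewrite h1 X12.
Qed.

Lemma germ_unique p f a b : germ p f a -> germ p f b -> a = b.
Proof.
move=> ha hb; have [p' [_ p'V _ _] h] := germ_common ha hb.
have [r Xr] := exponent_nonempty p'V; have [-> /eqP] := h r Xr.
by rewrite eqn_pmul2r ?lt0n // => /eqP.
Qed.

(** Homogeneous operations commute with taking germs; besides sums, differences and
    minima they include cutting off along a support. *)
Definition homogeneous (h : nat -> nat -> nat) :=
  forall a b x, (0 < x)%N -> h (a * x)%N (b * x)%N = (h a b * x)%N.

Lemma homogeneous_add : homogeneous addn.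
Proof. by move=> a b x _; rewrite mulnDl. Qed.

Lemma homogeneous_sub : homogeneous subn.
Proof. by move=> a b x _; rewrite mulnBl. Qed.

Lemma homogeneous_min : homogeneous minn.
Proof. by move=> a b x _; rewrite minnMl. Qed.

Definition restrict_in (a b : nat) := if b == 0%N then 0%N else a.
Definition restrict_out (a b : nat) := if b == 0%N then a else 0%N.

Lemma homogeneous_restrict_in : homogeneous restrict_in.
Proof.
move=> a b x x0; rewrite /restrict_in muln_eq0 (gtn_eqF x0) orbF.
by case: eqP.
Qed.

Lemma homogeneous_restrict_out : homogeneous restrict_out.
Proof.
move=> a b x x0; rewrite /restrict_out muln_eq0 (gtn_eqF x0) orbF.
by case: eqP.
Qed.

Lemma germ_map2 h p f g a b : homogeneous h -> germ p f a -> germ p g b ->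
  germ p (fun r => h (f r) (g r)) (h a b).
Proof.
move=> hh ha hb; have [p' pp' fg] := germ_common ha hb.
by exists p' => // r Xr; have [-> ->] := fg r Xr; rewrite hh ?lt0n.
Qed.

Lemma local_map2 h f g : homogeneous h -> is_local f -> is_local g ->
  is_local (fun r => h (f r) (g r)).
Proof.
move=> hh lf lg p pV; have [a ha] := lf p pV; have [b hb] := lg p pV.
by exists (h a b); exact: germ_map2.
Qed.

Lemma local_exponent q : vertices q -> is_local (X q).
Proof.
move=> qV p pV; have [p' [c [pp' h _]]] := germ_vertex pV qV.
by exists c; exists p'.
Qed.

Lemma germ0 p : vertices p -> germ p (fun=> 0%N) 0.
Proof. by move=> pV; exists p. Qed.

Lemma local_monomial f : is_monomial f -> is_local f.
Proof.
move=> [s sV ->] p pV; elim: s sV => [|q s IH] sV.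
  by exists 0%N; under eq_fun do rewrite big_nil; exact: germ0.
have [a ha] := local_exponent (sV q (mem_head _ _)) pV.
have [|b hb] := IH; first by move=> z zs; apply: sV; rewrite inE zs orbT.
exists (a + b)%N; under eq_fun do rewrite big_cons.
exact: germ_map2 homogeneous_add ha hb.
Qed.

Lemma is_monomial0 : is_monomial (fun=> 0%N).
Proof. by have := monomial_one_subproof alpha; rewrite inE. Qed.

Lemma is_monomialD f g : is_monomial f -> is_monomial g ->
  is_monomial (fun r => f r + g r)%N.
Proof.
move=> hf hg; have := monomial_mul_subproof
  (SigSub (mem_set hf) : monomial alpha) (SigSub (mem_set hg) : monomial alpha).
by rewrite inE.
Qed.

Lemma is_monomialX p : vertices p -> is_monomial (X p).
Proof.
move=> pV; exists [:: p] => [q|]; first by rewrite inE => /eqP ->.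
by apply/funext => r; rewrite big_seq1.
Qed.

Lemma is_monomialM c f : is_monomial f -> is_monomial (fun r => c * f r)%N.
Proof.
move=> hf; elim: c => [|c IH]; first exact: is_monomial0.
by under eq_fun do rewrite mulSn; exact: is_monomialD.
Qed.

Lemma restrictD f g :
  f = (fun r => restrict_in (f r) (g r) + restrict_out (f r) (g r))%N.
Proof.
by apply/funext => r; rewrite /restrict_in /restrict_out; case: eqP => //; rewrite addn0.
Qed.

Let monomial_on z := forall f, is_local f ->
  (forall r, f r != 0%N -> X z r != 0%N) -> is_monomial f.

(** A function supported in several vertices is split along their supports, one
    vertex at a time. *)
Lemma monomial_cover (L : seq (W * (W -> W))) f :
  (forall z, z \in L -> vertices z /\ monomial_on z) -> is_local f ->
  (forall r, f r != 0%N -> exists2 z, z \in L & X z r != 0%N) -> is_monomial f.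
Proof.
elim: L f => [|z L IH] f LP lf fL.
  suff -> : f = fun=> 0%N by exact: is_monomial0.
  by apply/funext => r; apply: contrapT => /eqP/fL[].
have [zV zc] := LP z (mem_head _ _); have lz := local_exponent zV.
rewrite (restrictD f (X z)); apply: is_monomialD.
  apply: zc; first exact: local_map2 homogeneous_restrict_in lf lz.
  by move=> r; rewrite /restrict_in; case: (eqVneq (X z r) 0%N).
apply: IH; first by move=> y yL; apply: LP; rewrite inE yL orbT.
  exact: local_map2 homogeneous_restrict_out lf lz.
move=> r; rewrite /restrict_out; case: (eqVneq (X z r) 0%N) => // Xz /fL[y].
by rewrite inE => /predU1P[->|yL] Xy; [rewrite Xz in Xy|exists y].
Qed.

(** Near the point of [p] the function is a multiple of a sibling of [p]; the rest of
    its support is covered by lower vertices, to which induction applies. *)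
Lemma local_monomial_on p : vertices p -> monomial_on p.
Proof.
elim/(@height_ind d W): p => p IH pV f lf fp.
have [c [p' pp' fc]] := lf p pV; have [_ p'V _ _] := pp'.
have lX := local_exponent p'V.
rewrite (restrictD f (X p')); apply: is_monomialD.
  suff -> : (fun r => restrict_in (f r) (X p' r)) = (fun r => c * X p' r)%N.
    by apply: is_monomialM; exact: is_monomialX.
  apply/funext => r; rewrite /restrict_in; case: eqP => [->|/eqP /fc //].
  by rewrite muln0.
have [L LP cov] := sibling_cover pp'.
apply: (@monomial_cover L).
- by move=> z /LP[zV zp]; split=> //; exact: IH.
- exact: local_map2 homogeneous_restrict_out lf lX.
- move=> r; rewrite /restrict_out; case: (eqVneq (X p' r) 0%N) => // Xr /fp /cov[|//].
  by rewrite Xr.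
Qed.

(** Together with [local_monomial], this describes monomials by a property that is
    inherited by minima and differences. *)
Lemma monomial_of_local f g : is_local f -> is_monomial g ->
  (forall r, f r != 0%N -> g r != 0%N) -> is_monomial f.
Proof.
move=> lf [s sV ->] fs; apply: (@monomial_cover s) => // [z zs|r /fs].
  by split; [exact: sV|apply: local_monomial_on; exact: sV].
rewrite sum_nat_seq_neq0 => /hasP[z zs /= Xz].
by exists z.
Qed.

Lemma monomialP m : is_monomial (val m).
Proof. by apply: set_mem; exact: (valP m). Qed.

Lemma monomial_map2 h m n : homogeneous h -> h 0%N 0%N = 0%N ->
  exists k, forall r, val k r = h (val m r) (val n r).
Proof.
move=> hh h0.
have km : is_monomial (fun r => h (val m r) (val n r)).
  apply: (monomial_of_local _ (is_monomialD (monomialP m) (monomialP n))).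
    by apply: local_map2 => //; apply: local_monomial; exact: monomialP.
  move=> r; apply: contraNneq => /eqP; rewrite addn_eq0 => /andP[/eqP -> /eqP ->].
  by rewrite h0.
by exists (SigSub (mem_set km)).
Qed.

Definition mval p m : nat := xget 0%N [set c | germ p (val m) c].

Lemma mvalP p m : vertices p -> germ p (val m) (mval p m).
Proof.
move=> pV; have [c hc] := local_monomial (monomialP m) pV.
exact: (@xgetPex _ 0%N [set c | germ p (val m) c] (ex_intro _ c hc)).
Qed.

Lemma mval_eq p m c : vertices p -> germ p (val m) c -> mval p m = c.
Proof. by move=> pV hc; apply: germ_unique hc; exact: mvalP. Qed.

Lemma mval_map2 h p m n k : vertices p -> homogeneous h ->
  (forall r, val k r = h (val m r) (val n r)) ->
  mval p k = h (mval p m) (mval p n).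
Proof.
move=> pV hh ek; apply: mval_eq => //.
have -> : val k = fun r => h (val m r) (val n r) by apply/funext.
by apply: germ_map2 => //; exact: mvalP.
Qed.

Lemma mvalM p m n : vertices p -> mval p (mmul m n) = (mval p m + mval p n)%N.
Proof. by move=> pV; apply: mval_map2 => //; exact: homogeneous_add. Qed.

Lemma mval1 p : vertices p -> mval p mone = 0%N.
Proof. by move=> pV; apply: mval_eq => //; exact: germ0. Qed.

Definition vertex_mon q : monomial alpha :=
  insubd (monomial_one alpha : set_type is_monomial) (X q).

Lemma val_vertex_mon q : vertices q -> val (vertex_mon q) = X q.
Proof.
by move=> qV; rewrite val_insubd ifT //; apply: mem_set; exact: is_monomialX.
Qed.

(** On vertices higher than [p] the valuation of [p] can also take larger powers of 2
    as values. *)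
Lemma mval_vertex p q : vertices p -> vertices q -> q.1 <= p.1 ->
  mval p (vertex_mon q) = `[< sibling p q >].
Proof.
move=> pV qV qp; apply: mval_eq => //; rewrite val_vertex_mon //.
by have [p' [c [pp' h /(_ qp) <-]]] := germ_vertex pV qV; exists p'.
Qed.

Lemma mval_vertex_self p : vertices p -> mval p (vertex_mon p) = 1%N.
Proof. by move=> pV; rewrite mval_vertex // asboolT //; exact: sibling_refl. Qed.

Lemma mval_vertex_lt p q : vertices p -> vertices q -> q.1 < p.1 ->
  mval p (vertex_mon q) = 0%N.
Proof.
move=> pV qV qp; rewrite mval_vertex ?(ltW qp) // asboolF // => -[_ _ e _].
by rewrite e ltxx in qp.
Qed.

Lemma monomial_ind (P : monomial alpha -> Prop) : P mone ->
  (forall q m, vertices q -> P m -> P (mmul (vertex_mon q) m)) -> forall m, P m.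
Proof.
move=> P1 PM m; have [s sV] := monomialP m.
elim: s m sV => [|q s IH] m sV em.
  suff -> : m = mone by [].
  by apply/val_inj; rewrite em; apply/funext => r; rewrite big_nil.
have qV : vertices q by apply: sV; rewrite inE eqxx.
have sV' z : z \in s -> vertices z by move=> zs; apply: sV; rewrite inE zs orbT.
have ms : is_monomial (fun r => \sum_(p <- s) X p r)%N by exists s.
have -> : m = mmul (vertex_mon q) (SigSub (mem_set ms)).
  by apply/val_inj; rewrite em /= val_vertex_mon //; apply/funext => r; rewrite big_cons.
by apply: PM => //; exact: IH.
Qed.

Lemma mval_proper m : m <> mone -> exists2 p, vertices p & (0 < mval p m)%N.
Proof.
elim/monomial_ind: m => [/(_ erefl) //|q m qV _ _]; exists q => //.
by rewrite mvalM // mval_vertex_self.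
Qed.

Lemma monomial_dvd m n : (forall r, val n r <= val m r)%N ->
  exists2 k, m = mmul n k & forall r, val k r = (val m r - val n r)%N.
Proof.
move=> nm; have [k ek] := monomial_map2 m n homogeneous_sub erefl.
exists k => //; apply/val_inj/funext => r.
by rewrite -[RHS]/(val n r + val k r)%N ek subnKC.
Qed.

Definition coprime_mon m n := forall p, vertices p -> mval p m = 0%N \/ mval p n = 0%N.

(** Disjointness of the supports passes to germs at all points. *)
Lemma coprime_monP m n : (forall r, minn (val m r) (val n r) = 0%N) -> coprime_mon m n.
Proof.
move=> h p pV.
have : mval p mone = minn (mval p m) (mval p n).
  by apply: mval_map2 => //; exact: homogeneous_min.
rewrite mval1 //; lia.
Qed.

(** The gcd is the pointwise minimum, and both cofactors are truncated
    differences. *)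
Lemma monomial_gcd m n : exists (g m' n' : monomial alpha),
  [/\ m = mmul g m', n = mmul g n' & coprime_mon m' n'].
Proof.
have [g eg] := monomial_map2 m n homogeneous_min erefl.
have [|m' em em'] := @monomial_dvd m g; first by move=> r; rewrite eg geq_minl.
have [|n' en en'] := @monomial_dvd n g; first by move=> r; rewrite eg geq_minr.
exists g, m', n'; split=> //; apply: coprime_monP => r.
rewrite em' en' eg; lia.
Qed.

(** A monomial of value 0 at [q] vanishes on the support of a small sibling of
    [q]. *)
Lemma coprime_neighborhood q m : vertices q -> mval q m = 0%N ->
  exists q', [/\ sibling q q', coprime_mon m (vertex_mon q') &
    forall r, val (vertex_mon q') r <= val (vertex_mon q) r]%N.
Proof.
move=> qV mq; have [q1 qq1] := mvalP m qV; rewrite mq => h.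
have [_ q1V _ _] := qq1.
have [q' [qq' mq' le]] : exists q', [/\ sibling q q',
    forall r, X q' r != 0%N -> val m r = 0%N & forall r, (X q' r <= X q r)%N].
  have [le|lt] := leP (q.2 q.1) (q1.2 q.1).
    exists q1; split=> // r; have [->//|X1] := eqVneq (X q1 r) 0%N.
    by rewrite (sibling_exponent qq1 le X1).
  exists q; split=> // r Xq; rewrite h //.
  have [_ _ e _] := qq1.
  by rewrite (sibling_exponent (sibling_sym qq1) _ Xq) // -e ltW.
have [_ q'V _ _] := qq'.
exists q'; split=> //; last by move=> r; rewrite !val_vertex_mon.
apply: coprime_monP => r; rewrite val_vertex_mon //.
by have [->|/mq' ->] := eqVneq (X q' r) 0%N; rewrite ?minn0 ?min0n.
Qed.

Lemma vertex_mon_edge p q : edge p q ->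
  exists m, vertex_mon p = mmul (vertex_mon q) (mmul (vertex_mon q) m).
Proof.
move=> pq; have qV := edge_vertex pq; have pV : vertices p by case: pq.
have [|m em _] := @monomial_dvd (vertex_mon p) (mmul (vertex_mon q) (vertex_mon q)).
  by move=> r; rewrite /= !val_vertex_mon // addnn -mul2n; exact: exponent_le_child.
by exists m; rewrite mulmA.
Qed.

End Monomials.

(** * The monoid algebra and contents *)

Section FractionRepresentation.
Import FracField generic_quotient.
Local Open Scope ring_scope.
Local Open Scope quotient_scope.

Lemma fracP (R : idomainType) (x : {fraction R}) :
  exists a b : R, b != 0 /\ x = tofrac a / tofrac b.
Proof.
elim/quotW: x => r; exists (frac r).1, (frac r).2; split; first exact: denom_ratioP.
unlock tofrac.
rewrite -[X in _ = _ * X]pi_inv -[RHS]pi_mul.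
by rewrite /mulf /invf /= !numden_Ratio ?oner_neq0 ?denom_ratioP // mulr1 mul1r Ratio_numden.
Qed.

End FractionRepresentation.

Section MonoidAlgebra.
Context {d : Order.disp_t} {W : ordinalsType d} (alpha : W) (F : fieldType).
Implicit Types (p q : W * (W -> W)) (m n k : monomial alpha).
Local Open Scope ring_scope.

Local Notation vertices := (vertices alpha).
Local Notation A := {malg F[monomial alpha]}.
Implicit Types (f g : A).

Lemma mmulI m : injective (mmul m).
Proof.
move=> n k e; apply/val_inj/funext => r.
by have := congr1 (fun m => val m r) e => /addnI.
Qed.

(** This makes [face_monomial p] multiplicative for every [p]. *)
Lemma mval_nonvertex p m : ~ vertices p -> mval p m = 0%N.
Proof.
by move=> npV; apply: xgetPN => c [p' [pV]].
Qed.

Definition face_monomial p m : A := if mval p m == 0%N then << m >> else 0.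

Lemma face_monomial_mmorphism p : mmorphism (face_monomial p).
Proof.
have [pV|npV] := pselect (vertices p); last first.
  split=> [m n|]; rewrite /face_monomial !mval_nonvertex //=.
  by rewrite malgM_def fgmulUU mulr1.
split=> [m n|]; rewrite /face_monomial ?mval1 // mvalM // addn_eq0.
by do 2!case: eqP; rewrite /= ?mul0r ?mulr0 // malgM_def fgmulUU mulr1.
Qed.

HB.instance Definition _ p := isMultiplicative.Build (monomial alpha) A
  (face_monomial p) (face_monomial_mmorphism p).

Local Notation face_map p :=
  (mmap (@malgC (monomial alpha) F) (face_monomial p)).

Fact face_key : unit. Proof. exact: tt. Qed.
(** Keeping only the terms of value 0 at [p] is a ring endomorphism, because [mval p]
    is additive and nonnegative.  It detects whether a content is trivial at [p]. *)
Definition face p : A -> A :=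
  locked_with face_key (face_map p).
Canonical face_unlockable p := [unlockable fun face p].

Lemma faceM p f g : face p (f * g) = face p f * face p g.
Proof. by rewrite [face p]unlock; exact: (rmorphM (face_map p)). Qed.

Lemma faceD p f g : face p (f + g) = face p f + face p g.
Proof. by rewrite [face p]unlock; exact: (raddfD (face_map p)). Qed.

Lemma face1 p : face p 1 = 1.
Proof. by rewrite [face p]unlock; exact: (rmorph1 (face_map p)). Qed.

Lemma face0 p : face p 0 = 0.
Proof. by rewrite [face p]unlock; exact: (raddf0 (face_map p)). Qed.

Lemma faceU p m : face p << m >> = face_monomial p m.
Proof. by rewrite [face p]unlock; apply: etrans (mmapU _ _) _; rewrite mul1r. Qed.

Lemma mcoeff_face p f m : (face p f)@_m = if mval p m == 0%N then f@_m else 0.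
Proof.
rewrite [face p]unlock raddf_sum /=.
under eq_bigr => k _ do rewrite mul_malgC mcoeffZ /face_monomial.
have [mf|mf] := boolP (m \in msupp f); last first.
  rewrite (mcoeff_outdom mf) if_same big1_seq // => k /andP[_ kf].
  case: ifP => _; rewrite ?mcoeff0 ?mulr0 // mcoeffU1.
  by case: eqP => [e|_]; [rewrite -e kf in mf|rewrite mulr0].
rewrite (bigD1_seq m) ?fset_uniq //= big1 ?addr0.
  by case: ifP => _; rewrite ?mcoeff0 ?mulr0 // mcoeffU1 eqxx mulr1.
move=> k /negPf km; case: ifP => _; rewrite ?mcoeff0 ?mulr0 //.
by rewrite mcoeffU1 km mulr0.
Qed.

Lemma mulUU m n : << m >> * << n >> = << mmul m n >> :> A.
Proof. by rewrite malgM_def fgmulUU mulr1. Qed.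

Lemma mcoeff_mulU k g m : (<< k >> * g)@_(mmul k m) = g@_m.
Proof.
rewrite {1}(monalgE g) mulr_sumr raddf_sum /=.
under eq_bigr => n _ do rewrite malgM_def fgmulUU mul1r mcoeffU (inj_eq (@mmulI k)).
by rewrite -[RHS](congr1 (mcoeff m) (esym (monalgE g))) raddf_sum /=;
  apply: eq_bigr => n _; rewrite mcoeffU.
Qed.

Fact mon_elt_key : unit. Proof. exact: tt. Qed.
Definition mon_elt : monomial alpha -> A := locked_with mon_elt_key (fun m => << m >>).
Canonical mon_elt_unlockable := [unlockable fun mon_elt].

Lemma mon_elt_neq0 m : mon_elt m != 0.
Proof. by rewrite unlock monalgU_eq0 oner_neq0. Qed.

Lemma mon_elt1 : mon_elt mone = 1.
Proof. by rewrite unlock. Qed.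

Lemma mon_eltM m n : mon_elt (mmul m n) = mon_elt m * mon_elt n.
Proof. by rewrite unlock mulUU. Qed.

Lemma mcoeff_mon_elt m n : (mon_elt m)@_n = (m == n)%:R.
Proof. by rewrite unlock mcoeffU1. Qed.

Lemma face_mon_elt p m : face p (mon_elt m) = if mval p m == 0%N then mon_elt m else 0.
Proof. by rewrite [mon_elt]unlock faceU. Qed.

Lemma mul_monomialI k : injective (fun f : A => mon_elt k * f).
Proof. rewrite unlock => f g e; apply/malgP => m.
by rewrite -(mcoeff_mulU k) e mcoeff_mulU. Qed.

Lemma monomial_list_gcd (s : seq (monomial alpha)) : s != [::] ->
  exists2 k, (forall m, m \in s -> exists m', m = mmul k m') &
    forall p, vertices p -> exists2 m, m \in s & mval p m = mval p k.
Proof.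
elim: s => // m [_ _|n s IH _].
  exists m => [m'|p pV]; last by exists m; rewrite ?inE.
  by rewrite inE => /eqP ->; exists mone; rewrite mulm1.
have [//|k kd kv] := IH; have [g [m' [k' [em ek co]]]] := monomial_gcd m k.
exists g => [l|p pV].
  rewrite inE => /predU1P[->|/kd[l' ->]]; first by exists m'.
  by exists (mmul k' l'); rewrite ek mulmA.
have [m'0|k'0] := co p pV.
  by exists m; rewrite ?mem_head // em mvalM // m'0 addn0.
have [l ls lk] := kv p pV; exists l; first by rewrite inE ls orbT.
by rewrite lk ek mvalM // k'0 addn0.
Qed.

(** The content is the gcd of the terms; at each [p] it has the same value as one of
    them, which leaves a term of value 0 in the cofactor. *)
Lemma content_exists f : f != 0 -> exists k g, f = mon_elt k * g /\
  forall p, vertices p -> face p g != 0.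
Proof.
move=> f0; have sf : enum_fset (msupp f) != [::].
  apply: contraNneq f0 => e; rewrite -msupp_eq0; apply/eqP/fsetP => m.
  by rewrite -[LHS]/(m \in enum_fset _) e inE.
have [k kd kv] := monomial_list_gcd sf.
have [g eg] : exists g, f = mon_elt k * g.
  have : forall s : seq (monomial alpha), {subset s <= enum_fset (msupp f)} ->
      exists g, \sum_(m <- s) << f@_m *g m >> = mon_elt k * g.
    elim=> [|m s IH] ss; first by exists 0; rewrite big_nil mulr0.
    have [|g eg] := IH; first by move=> n ns; apply: ss; rewrite inE ns orbT.
    have [m' em] := kd m (ss _ (mem_head _ _)).
    exists (<< f@_m *g m' >> + g); rewrite big_cons eg mulrDr; congr (_ + _).
    by rewrite unlock malgM_def fgmulUU mul1r -em.
  by move=> /(_ (enum_fset (msupp f)))[//|g eg]; exists g; rewrite -eg -monalgE.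
exists k, g; split=> // p pV; have [m ms mk] := kv p pV.
have [m' em] := kd m ms.
have m'0 : mval p m' = 0%N by move: mk; rewrite em mvalM //; lia.
apply/eqP => /(congr1 (mcoeff m')); rewrite mcoeff_face m'0 /= mcoeff0.
have := mcoeff_mulU k g m'.
move: eg; rewrite unlock => <- <-; rewrite -em => /eqP; rewrite mcoeff_eq0.
by rewrite -[m \in _]/(m \in enum_fset _) ms.
Qed.

End MonoidAlgebra.

Section ContentOne.
Context {d : Order.disp_t} {W : ordinalsType d} (alpha : W) (F : fieldType).
Hypothesis alpha_gt0 : \bot < alpha.
Implicit Types (p q : W * (W -> W)) (m n k : monomial alpha).
Local Open Scope ring_scope.

Local Notation vertices := (vertices alpha).
Local Notation A := {malg F[monomial alpha]}.
Local Notation S := (Sset alpha F : set A).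
Implicit Types (f g : A).

Lemma exists_vertex (beta : W) : (beta < alpha)%O -> exists2 p, vertices p & p.1 = beta.
Proof.
move=> ba; exists (beta, fun=> \bot) => //; split=> //; split=> //.
- by split=> // gamma; left; exists 0%N.
- by rewrite (_ : [set _ | _] = set0) //; apply/seteqP; split=> x //=; rewrite eqxx.
- by move=> *; exists 0%N.
- by case=> _ /limit_gt0.
Qed.

Lemma SsetE f : S f <-> forall m, m != mone -> ~ exists h : A, f = mon_elt F m * h.
Proof. by rewrite unlock. Qed.

(** Since F[X] is a domain, this characterization makes S multiplicative. *)
Lemma SsetP f : S f <-> forall p, vertices p -> face p f != 0.
Proof.
split=> [/SsetE Sf|fP]; last first.
  apply/SsetE => m m1 [h fh]; have [|p pV pm0] := @mval_proper _ _ _ m; first by apply/eqP.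
  case/negP: (fP p pV); rewrite fh faceM face_mon_elt gtn_eqF //.
  by rewrite mul0r.
have f0 : f != 0.
  apply/eqP => f0; have [p pV _] := exists_vertex alpha_gt0.
  apply: (Sf (vertex_mon alpha p)); last by exists 0; rewrite mulr0.
  apply/eqP => /(congr1 (mval p)).
  by rewrite mval1 // mval_vertex_self.
have [k [g [e gP]]] := content_exists f0.
have [k1|k1] := eqVneq k mone; last by case: (Sf k k1); exists g.
suff -> : f = g by [].
by rewrite e k1 mon_elt1 mul1r.
Qed.

Lemma Sset_neq0 f : S f -> f != 0.
Proof.
move=> /SsetP; have [p pV _] := exists_vertex alpha_gt0.
by move=> /(_ p pV); apply: contraNneq => ->; rewrite face0.
Qed.

Lemma SsetM f g : S f -> S g -> S (f * g).
Proof.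
move=> /SsetP fP /SsetP gP; apply/SsetP => p pV.
rewrite faceM; apply/negP => /eqP /polyX_integral /orP[].
  exact/negP/fP.
exact/negP/gP.
Qed.

Lemma Sset1 : S 1.
Proof. by apply/SsetP => p pV; rewrite face1 oner_neq0. Qed.

(** At each point one of two coprime monomials has value 0.  They must be distinct,
    for 1 + 1 may vanish. *)
Lemma Sset_add_coprime m n : m != n -> coprime_mon m n -> S (mon_elt F m + mon_elt F n).
Proof.
move=> mn co; apply/SsetP => p pV; rewrite faceD !face_mon_elt.
case: (eqVneq (mval p m) 0%N) => m0; case: (eqVneq (mval p n) 0%N) => n0.
- apply/eqP => /(congr1 (mcoeff m)); rewrite mcoeffD !mcoeff_mon_elt eqxx mcoeff0.
  by rewrite eq_sym (negPf mn) addr0 => /eqP; rewrite oner_eq0.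
- by rewrite addr0 mon_elt_neq0.
- by rewrite add0r mon_elt_neq0.
- by case: (co p pV) => e; rewrite e eqxx in m0 n0.
Qed.

(** After removing the gcd of [m] and [m'], a nontrivial cofactor of [m] would have
    positive value at a point where both the cofactor of [m'] and [f'] do not. *)
Lemma content_part_unique m m' f f' : S f -> S f' ->
  mon_elt F m * f = mon_elt F m' * f' -> m = m'.
Proof.
move=> Sf Sf' e; have [g [a [a' [em em' co]]]] := monomial_gcd m m'.
have {}e : mon_elt F a * f = mon_elt F a' * f'.
  have split_mon b h : mon_elt F (mmul g b) * h = mon_elt F g * (mon_elt F b * h).
    by rewrite mon_eltM; exact: esym (mulrA _ _ _).
  by move: e; rewrite em em' !split_mon => /mul_monomialI.
have half b b' h h' : coprime_mon b b' -> S h' ->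
    mon_elt F b * h = mon_elt F b' * h' -> b = mone.
  move=> cb Sh' eb; apply: contrapT => /mval_proper[p pV pb].
  have b'0 : mval p b' = 0%N.
    by move: (cb p pV) pb; clear; case=> [->|].
  have zero : face p (mon_elt F b') * face p h' = 0.
    have b0 : face p (mon_elt F b) = 0 by rewrite face_mon_elt gtn_eqF.
    apply: etrans (esym (faceM p (mon_elt F b') h')) _.
    apply: etrans (congr1 (face p) (esym eb)) _.
    apply: etrans (faceM p (mon_elt F b) h) _.
    apply: etrans (congr1 (fun z => z * face p h) b0) _.
    exact: mul0r.
  case/orP: (polyX_integral zero) => /eqP.
    by move/eqP; rewrite face_mon_elt b'0 /= (negPf (mon_elt_neq0 _ _)).
  by have /SsetP/(_ p pV)/eqP := Sh'.
have a1 := half a a' f f' co Sf' e.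
have co' : coprime_mon a' a by move=> p /co []; [right|left].
have a'1 := half a' a f' f co' Sf (esym e).
by rewrite em em' a1 a'1.
Qed.

End ContentOne.

(** * Valuations on the quotient field *)

Section Valuations.
Context {d : Order.disp_t} {W : ordinalsType d} (alpha : W).
Local Open Scope ring_scope.
Local Notation vertices := (vertices alpha).
Implicit Types (p q : W * (W -> W)) (m n k : monomial alpha).

(** What the rest of the proof needs from the quotient field of F[X]: [X] embeds the
    monomials, [U] is the group of quotients of elements of S, and each nonzero
    element is a quotient of monomials times an element of [U].  The condition
    [content_add] puts sums under control: a combination of monomials with
    coefficients in [U] has a content. *)
Record content_theory (K : fieldType) (X : monomial alpha -> K) (U : set K) := {
  content_X1 : X mone = 1;
  content_XM : forall m n, X (mmul m n) = X m * X n;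
  content_X_neq0 : forall m, X m != 0;
  content_U1 : U 1;
  content_UM : forall u w, U u -> U w -> U (u * w);
  content_UV : forall u, U u -> U u^-1;
  content_U_neq0 : forall u, U u -> u != 0;
  content_repr : forall x, x != 0 -> exists m n u, U u /\ x = u * X m / X n;
  content_unique : forall m n u w, U u -> U w -> u * X m = w * X n -> m = n;
  content_add : forall m n u w, U u -> U w -> u * X m + w * X n != 0 ->
    exists k t, U t /\ u * X m + w * X n = t * X k;
  content_add_coprime : forall m n, m != n -> coprime_mon m n -> U (X m + X n)
}.

Context (K : fieldType) (X : monomial alpha -> K) (U : set K).
Hypothesis H : content_theory X U.
Implicit Types (x y u w : K).

Let X1 := content_X1 H.
Let XM := content_XM H.
Let X0 := content_X_neq0 H.
Let U1 := content_U1 H.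
Let UM := content_UM H.
Let UV := content_UV H.
Let U0 := content_U_neq0 H.

Definition pval_spec p x (c : int) := exists m n u,
  [/\ U u, x = u * X m / X n & c = (mval p m)%:Z - (mval p n)%:Z].

(** Well defined by the uniqueness of contents ([pvalE]); the default value 0 is that
    of [x = 0]. *)
Definition pval p x : int := xget 0 [set c | pval_spec p x c].

Lemma pvalE p m n u : vertices p -> U u ->
  pval p (u * X m / X n) = (mval p m)%:Z - (mval p n)%:Z.
Proof.
move=> pV Uu; rewrite /pval.
have /(@xgetPex _ 0%R) [m' [n' [u' [Uu' e ->]]]] :
    exists c, [set c | pval_spec p (u * X m / X n) c] c.
  by eexists; exists m, n, u.
move/eqP: e; rewrite eqr_div ?X0 // -!mulrA -!XM => /eqP e.
have /(congr1 (mval p)) := content_unique H Uu Uu' e.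
rewrite !mvalM //; lia.
Qed.

Lemma repr_coprime x : x != 0 -> exists m n u,
  [/\ U u, coprime_mon m n & x = u * X m / X n].
Proof.
case/(content_repr H) => m [n [u [Uu ->]]].
have [l [m' [n' [-> -> co]]]] := monomial_gcd m n.
exists m', n', u; split=> //; rewrite !XM.
by field; rewrite !X0.
Qed.

Lemma pvalM p x y : vertices p -> x != 0 -> y != 0 -> pval p (x * y) = pval p x + pval p y.
Proof.
move=> pV /(content_repr H)[m [n [u [Uu ->]]]] /(content_repr H)[m' [n' [u' [Uu' ->]]]].
rewrite mulf_div mulrACA -!XM !pvalE ?mvalM //; last exact: UM.
lia.
Qed.

Lemma pval_X p m : vertices p -> pval p (X m) = (mval p m)%:Z.
Proof.
move=> pV; have -> : X m = 1 * X m / X mone by rewrite X1 divr1 mul1r.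
by rewrite pvalE // mval1 // subr0.
Qed.

Lemma pval_U p u : vertices p -> U u -> pval p u = 0.
Proof.
move=> pV Uu; have -> : u = u * X mone / X mone by rewrite X1 mulr1 divr1.
by rewrite pvalE // subrr.
Qed.

Lemma pval1 p : vertices p -> pval p 1 = 0.
Proof. by move=> pV; exact: pval_U. Qed.

Lemma pvalV p x : vertices p -> x != 0 -> pval p x^-1 = - pval p x.
Proof.
move=> pV x0; have Vx0 : x^-1 != 0 by rewrite invr_eq0.
have := pvalM pV Vx0 x0; rewrite mulVf // pval1 // => /esym/eqP.
by rewrite addr_eq0 => /eqP.
Qed.

Lemma pvalN p x : vertices p -> x != 0 -> pval p (- x) = pval p x.
Proof.
move=> pV x0; have N0 : (-1 : K) != 0 by rewrite oppr_eq0 oner_eq0.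
have := pvalM pV N0 N0; rewrite mulrNN mulr1 pval1 // => e.
rewrite -mulN1r (pvalM pV N0 x0); lia.
Qed.

Lemma pvalXn p x i : vertices p -> x != 0 -> pval p (x ^+ i) = pval p x * i%:Z.
Proof.
move=> pV x0; elim: i => [|i IH]; first by rewrite expr0 pval1 // mulr0.
rewrite exprS pvalM ?expf_neq0 // IH; lia.
Qed.

(** Over a common denominator, the gcd of both numerators divides the content of
    their sum, and at [p] it has the smaller of their values. *)
Lemma pvalD p x y : vertices p -> x != 0 -> y != 0 -> x + y != 0 ->
  Num.min (pval p x) (pval p y) <= pval p (x + y).
Proof.
move=> pV /(content_repr H)[m [n [u [Uu ->]]]] /(content_repr H)[m' [n' [u' [Uu' ->]]]].
have [l [a [a' [ea ea' co]]]] := monomial_gcd (mmul m n') (mmul m' n).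
have exy : u * X m / X n + u' * X m' / X n' =
    (u * X a + u' * X a') * X l / X (mmul n n').
  have Ea : X m * X n' = X l * X a by rewrite -!XM ea.
  have Ea' : X m' * X n = X l * X a' by rewrite -!XM ea'.
  rewrite addf_div ?X0 // XM; congr (_ / _).
  by rewrite -[u * _ * _]mulrA -[u' * _ * _]mulrA Ea Ea'; ring.
rewrite exy => s0.
have [|k [t [Ut et]]] := content_add H (u := u) (w := u') (m := a) (n := a') Uu Uu'.
  by apply: contraNneq s0 => ->; rewrite !mul0r.
rewrite et -[t * _ * _]mulrA -XM !pvalE //.
have := congr1 (mval p) ea; have := congr1 (mval p) ea'; rewrite !mvalM //.
case: (co p pV); lia.
Qed.

Lemma pval_discrete p : vertices p -> is_discrete_valuation (pval p).
Proof.
move=> pV; split=> [x y|x y|]; [exact: pvalM|exact: pvalD|].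
have Xp := pval_X (vertex_mon alpha p) pV; rewrite mval_vertex_self // in Xp.
case=> i.
  by exists (X (vertex_mon alpha p) ^+ i); rewrite ?expf_neq0 ?pvalXn ?X0 // Xp mul1r.
exists (X (vertex_mon alpha p) ^- i.+1); first by rewrite invr_eq0 expf_neq0 ?X0.
by rewrite pvalV ?pvalXn ?expf_neq0 ?X0 // Xp mul1r.
Qed.

(** The ring T_beta; for [beta = \bot] it is D. *)
Definition height_ring (beta : W) : set K :=
  [set x | x != 0 -> forall p, vertices p -> (beta <= p.1)%O -> 0 <= pval p x].

(** The maximal ideal of T_beta at the point of [p], meaningful when the height of
    [p] is at least [beta]. *)
Definition point_ideal (beta : W) p : set K :=
  [set x | height_ring beta x /\ (x != 0 -> 0 < pval p x)].

Lemma height_ring0 beta : height_ring beta 0.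
Proof. by rewrite /height_ring /= eqxx. Qed.

Lemma height_ring1 beta : height_ring beta 1.
Proof. by move=> _ p pV _; rewrite pval1. Qed.

Lemma height_ringM beta x y :
  height_ring beta x -> height_ring beta y -> height_ring beta (x * y).
Proof.
move=> Tx Ty; rewrite /height_ring /= mulf_eq0 negb_or => /andP[x0 y0] p pV bp.
by rewrite pvalM // addr_ge0 // ?Tx ?Ty.
Qed.

Lemma height_ringN beta x : height_ring beta x -> height_ring beta (- x).
Proof.
by move=> Tx; rewrite /height_ring /= oppr_eq0 => x0 p pV bp; rewrite pvalN // Tx.
Qed.

Lemma height_ringD beta x y :
  height_ring beta x -> height_ring beta y -> height_ring beta (x + y).
Proof.
have [->|x0] := eqVneq x 0; first by rewrite add0r.
have [->|y0] := eqVneq y 0; first by rewrite addr0.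
move=> Tx Ty xy0 p pV bp; apply: le_trans (pvalD pV x0 y0 xy0).
by rewrite le_min Tx ?Ty.
Qed.

Lemma height_ring_subring beta : is_subring (height_ring beta).
Proof.
split=> [|x y|x y]; rewrite !inE; first exact: height_ring1.
  by move=> Tx Ty; apply: height_ringD => //; exact: height_ringN.
exact: height_ringM.
Qed.

Lemma height_ring_le beta gamma x :
  (beta <= gamma)%O -> height_ring beta x -> height_ring gamma x.
Proof. by move=> bg Tx x0 p pV gp; apply: Tx => //; exact: le_trans gp. Qed.

Lemma height_ring_X beta m : height_ring beta (X m).
Proof. by move=> _ p pV _; rewrite pval_X. Qed.

Lemma height_ring_U beta u : U u -> height_ring beta u.
Proof. by move=> Uu _ p pV _; rewrite pval_U. Qed.

Lemma height_ring_XV beta m : (forall p, vertices p -> (beta <= p.1)%O -> mval p m = 0%N) ->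
  height_ring beta (X m)^-1.
Proof. by move=> h _ p pV bp; rewrite pvalV ?X0 // pval_X // h. Qed.

(** Write the element with coprime numerator and denominator.  Where the
    denominator has positive value the numerator has value 0, which is excluded at
    points of height at least [beta]; so the denominator is a unit of T_beta. *)
Lemma height_ring_decomp beta x : height_ring beta x -> x != 0 -> exists m w,
  [/\ x = w * X m, w != 0, height_ring beta w, height_ring beta w^-1 &
      forall p, vertices p -> (beta <= p.1)%O -> pval p x = (mval p m)%:Z].
Proof.
move=> Tx x0; have [m [n [u [Uu co ex]]]] := repr_coprime x0.
have n0 p : vertices p -> (beta <= p.1)%O -> mval p n = 0%N.
  move=> pV bp; have := Tx x0 p pV bp; rewrite ex pvalE //.
  case: (co p pV); lia.
have u0 := U0 Uu.
exists m, (u / X n); split.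
- by rewrite ex mulrAC.
- by rewrite mulf_neq0 ?invr_eq0 ?X0.
- by apply: height_ringM; [exact: height_ring_U|exact: height_ring_XV].
- by rewrite invf_div; apply: height_ringM; [exact: height_ring_X|apply: height_ring_U; exact: UV].
- by move=> p pV bp; rewrite ex pvalE // n0 // subr0.
Qed.

End Valuations.

(** * Generated ideals and maximal ideals *)

Section Ideals.
Context {K : fieldType}.
Implicit Types (R I J N : set K).
Local Open Scope ring_scope.

Lemma span_sub R (A : set K) J : is_ideal R J -> A `<=` J -> ideal_span R A `<=` J.
Proof. by move=> iJ AJ; exact: smallest_sub. Qed.

Lemma sub_span R (A : set K) : A `<=` ideal_span R A.
Proof. exact: sub_gen_smallest. Qed.

Lemma subring_ideal R : is_subring R -> is_ideal R R.
Proof.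
move=> sR; have [R1 RB RM] := sR; rewrite /prop_in2 in RB RM.
have R0 : R 0 by have := RB _ _ R1 R1; rewrite subrr inE.
split=> // [x y Rx Ry|a x Ra Rx]; last first.
  by have := RM a x; rewrite !inE; exact.
have Ry' : R (- y) by have := RB 0 y; rewrite !inE sub0r; exact.
by have := RB x (- y); rewrite !inE opprK; exact.
Qed.

Lemma span_ideal R (A : set K) : is_subring R -> A `<=` R ->
  is_ideal R (ideal_span R A).
Proof.
move=> sR AR; split.
- by apply: span_sub => //; exact: subring_ideal.
- by move=> J [[]].
- move=> x y Ax Ay J JA; have [[_ _ JD _] _] := JA.
  by apply: JD; [exact: Ax|exact: Ay].
- move=> a x Ra Ax J JA; have [[_ _ _ JM] _] := JA.
  by apply: JM => //; exact: Ax.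
Qed.

Lemma ideal_one R I : is_ideal R I -> I 1 -> I = R.
Proof.
move=> [IR _ _ IM] I1; apply/seteqP; split=> // x Rx.
by rewrite -[x]mulr1; exact: IM.
Qed.

Lemma Max_prime R N a b : is_subring R -> Max R N -> R a -> R b ->
  N (a * b) -> N a \/ N b.
Proof.
move=> sR [iN NR Nmax] Ra Rb Nab; have [Na|nNa] := pselect (N a); first by left.
right; have [RR R0 RD RM] := subring_ideal sR; have [NsR N0 ND NM] := iN.
have R1 : R 1 by case: sR => + _ _; rewrite inE.
pose J := [set x | exists2 n, N n & exists2 r, R r & x = n + r * a].
have iJ : is_ideal R J.
  split.
  - move=> _ [n Nn [r Rr ->]]; apply: RD; first exact: NsR.
    exact: RM.
  - by exists 0 => //; exists 0; rewrite ?mul0r ?addr0.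
  - move=> _ _ [n Nn [r Rr ->]] [n' Nn' [r' Rr' ->]].
    exists (n + n'); first exact: ND.
    by exists (r + r'); [exact: RD|rewrite mulrDl addrACA].
  - move=> c _ Rc [n Nn [r Rr ->]]; exists (c * n); first exact: NM.
    by exists (c * r); [exact: RM|rewrite mulrDr mulrA].
have NJ : N `<=` J by move=> x Nx; exists x => //; exists 0; rewrite ?mul0r ?addr0.
have Ja : J a by exists 0 => //; exists 1; rewrite ?mul1r ?add0r.
case: (Nmax J iJ NJ) => [JN|JR]; first by rewrite -JN in nNa.
have : J 1 by rewrite JR.
move=> [n Nn [r Rr e]]; rewrite -[b]mul1r e mulrDl; apply: ND.
  by rewrite mulrC; exact: NM.
by rewrite -mulrA; exact: NM.
Qed.

End Ideals.

(** * Maximal and critical ideals *)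

Section Maximal.
Context {d : Order.disp_t} {W : ordinalsType d} (alpha : W).
Local Open Scope ring_scope.
Local Notation vertices := (vertices alpha).
Local Notation edge := (edge alpha).
Implicit Types (p q z : W * (W -> W)) (m n k : monomial alpha) (beta : W).
Context (K : fieldType) (X : monomial alpha -> K) (U : set K).
Hypothesis H : content_theory X U.
Implicit Types (x y u w : K).

Let X1 := content_X1 H.
Let XM := content_XM H.
Let X0 := content_X_neq0 H.
Let U0 := content_U_neq0 H.

Local Notation T := (height_ring X U).
Local Notation M := (point_ideal X U).
Local Notation v := (pval X U).

Lemma point_ideal_ideal beta p : vertices p -> (beta <= p.1)%O -> is_ideal (T beta) (M beta p).
Proof.
move=> pV bp; split.
- by move=> x [].
- by split; [exact: height_ring0|rewrite eqxx].
- move=> x y [Tx Mx] [Ty My]; split; first exact: (height_ringD H).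
  have [->|x0] := eqVneq x 0; first by rewrite add0r.
  have [->|y0] := eqVneq y 0; first by rewrite addr0.
  move=> xy0; apply: lt_le_trans (pvalD H pV x0 y0 xy0).
  by rewrite lt_min Mx ?My.
- move=> a x Ta [Tx Mx]; split; first exact: (height_ringM H).
  rewrite mulf_eq0 negb_or => /andP[a0 x0].
  by rewrite (pvalM H) // ltr_wpDl // ?Ta ?Mx.
Qed.

Lemma point_ideal_proper beta p : vertices p -> ~ M beta p 1.
Proof. by move=> pV [_ /(_ (oner_neq0 _))]; rewrite (pval1 H) // ltxx. Qed.

Lemma point_ideal_X beta p m : vertices p -> (0 < mval p m)%N -> M beta p (X m).
Proof. by move=> pV mon_elt; split; [exact: height_ring_X|rewrite (pval_X H)]. Qed.

Lemma mval_sibling p q : sibling alpha p q -> mval p (vertex_mon alpha q) = 1%N.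
Proof.
by move=> pq; have [pV qV e _] := pq; rewrite mval_vertex ?e // asboolT.
Qed.

(** The sum of two distinct coprime monomials is a unit of D. *)
Lemma coprime_unit beta I m n : is_ideal (T beta) I -> I (X m) -> I (X n) ->
  m != n -> coprime_mon m n -> I = T beta.
Proof.
move=> iI Im In mn co; have [IT I0 ID IM] := iI; apply: ideal_one => //.
have Us := content_add_coprime H mn co.
rewrite -(mulVf (U0 Us)); apply: IM; last exact: ID.
by apply: height_ring_U => //; exact: (content_UV H).
Qed.

(** An element of value 0 is up to a unit a monomial of value 0; this is coprime to a
    sibling of [p], which lies in the ideal of [p]. *)
Lemma point_ideal_max beta p : vertices p -> (beta <= p.1)%O -> Max (T beta) (M beta p).
Proof.
move=> pV bp; have iM := point_ideal_ideal pV bp; split=> // [e|I iI MI].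
  by apply: (@point_ideal_proper beta p) => //; rewrite e; exact: height_ring1.
have [IM|/existsNP[x /not_implyP[Ix nMx]]] := pselect (I `<=` M beta p).
  by left; apply/seteqP.
right; have [IT I0 ID Imul] := iI.
have x0 : x != 0 by apply/eqP => e; apply: nMx; rewrite e; case: iM.
have Tx := IT x Ix.
have [m [w [ex w0 Tw TwV vx]]] := height_ring_decomp H Tx x0.
have mon_elt : mval p m = 0%N.
  have : ~ 0 < v p x by move=> h; apply: nMx; split.
  by rewrite vx //; case: (mval p m).
have [q [pq co _]] := coprime_neighborhood pV mon_elt.
apply: (@coprime_unit beta I m (vertex_mon alpha q)) => //.
- by have -> : X m = w^-1 * x; [rewrite ex mulKf|exact: Imul].
- by apply: MI; apply: point_ideal_X => //; rewrite mval_sibling.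
- by apply/eqP => /(congr1 (mval p)); rewrite mval_sibling // mon_elt.
Qed.

(** The point is that of a vertex [q] of minimal height among those in [N].  If a
    monomial in [N] had value 0 at [q], some sibling [q'] of [q] with
    [X q = X q' * X rho] would be coprime to it, hence not in [N]; so [N] would
    contain a vertex dividing [rho].  But [rho] has value 0 at all points at least
    as high as [q], whereas this vertex has value 1 at its own. *)
Lemma height_ring_Max beta N : (beta < alpha)%O -> Max (T beta) N ->
  exists2 p, vertices p /\ (beta <= p.1)%O & N = M beta p.
Proof.
move=> ba maxN; have [iN NT Nmax] := maxN; have [NsT N0 ND NM] := iN.
have sT := height_ring_subring H beta.
have inM p : vertices p -> (beta <= p.1)%O -> N `<=` M beta p -> N = M beta p.
  move=> pV bp NMp; case: (Nmax _ (point_ideal_ideal pV bp) NMp) => [-> //|e].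
  by case: (@point_ideal_proper beta p pV); rewrite e; exact: height_ring1.
(* If N = 0, then N lies in the ideal of any point of height beta. *)
have [p0 p0V ep0] := exists_vertex ba.
have [[x [Nx x0]]|none] := pselect (exists x, N x /\ x != 0); last first.
  exists p0; first by rewrite ep0.
  apply: inM; rewrite ?ep0 // => x Nx.
  suff -> : x = 0 by case: (@point_ideal_ideal beta p0); rewrite ?ep0.
  by apply: contrapT => /eqP x0; apply: none; exists x.
have monN m : N (X m) -> exists2 q, vertices q & N (X (vertex_mon alpha q)) /\
    forall z, vertices z -> mval z (vertex_mon alpha q) = 1%N -> (0 < mval z m)%N.
  elim/(@monomial_ind d W alpha): m => [|q m qV IH].
    by rewrite X1 => /(ideal_one iN).
  rewrite XM => /(Max_prime sT maxN)[||Nq|/IH[q' q'V [Nq' h]]]; try exact: height_ring_X.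
    by exists q => //; split=> // z zV e; rewrite mvalM // e.
  by exists q' => //; split=> // z zV /(h z zV) zm; rewrite mvalM // addn_gt0 zm orbT.
have toX y : N y -> y != 0 -> exists2 m, N (X m) &
    forall p, vertices p -> (beta <= p.1)%O -> v p y = (mval p m)%:Z.
  move=> Ny y0; have [m [w [ey w0 Tw TwV vy]]] := height_ring_decomp H (NsT y Ny) y0.
  by exists m => //; have -> : X m = w^-1 * y; [rewrite ey mulKf|exact: NM].
have [m0 Nm0 _] := toX x Nx x0.
have [q0 q0V [Nq0 _]] := monN m0 Nm0.
have [q [qV Nq qmin]] : exists q, [/\ vertices q, N (X (vertex_mon alpha q)) &
    forall z, vertices z -> N (X (vertex_mon alpha z)) -> (q.1 <= z.1)%O].
  elim/(@height_ind d W): q0 q0V Nq0 => q IH qV Nq.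
  have [[z [zV Nz zq]]|no] :=
      pselect (exists z, [/\ vertices z, N (X (vertex_mon alpha z)) & (z.1 < q.1)%O]).
    exact: (IH z).
  exists q; split=> // z zV Nz; rewrite leNgt; apply/negP => zq.
  by apply: no; exists z.
have bq : (beta <= q.1)%O.
  rewrite leNgt; apply/negP => qb; apply: NT; apply: ideal_one => //.
  rewrite -(mulVf (X0 (vertex_mon alpha q))); apply: NM => //; apply: height_ring_XV => // p pV bp.
  by apply: mval_vertex_lt => //; exact: lt_le_trans bp.
exists q => //; apply: inM => // y Ny; split; first exact: NsT.
move=> y0; have [m Nm vy] := toX y Ny y0; rewrite vy //.
have [qm0|] := posnP (mval q m); last by [].
have [q' [qq' co le]] := coprime_neighborhood qV qm0; have [_ q'V eq' _] := qq'.
have nNq' : ~ N (X (vertex_mon alpha q')).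
  move=> Nq'; apply: NT; apply: (coprime_unit iN Nm Nq') => //.
  by apply/eqP => /(congr1 (mval q)); rewrite mval_sibling // qm0.
have [rho er _] := monomial_dvd le.
have Nr : N (X rho).
  move: Nq; rewrite er XM => /(Max_prime sT maxN)[||//|//]; exact: height_ring_X.
have [z zV [Nz zr]] := monN rho Nr.
have qz := qmin z zV Nz.
have := zr z zV (mval_vertex_self zV).
have := congr1 (mval z) er; rewrite mvalM // !mval_vertex -?eq' //.
have -> : `[< sibling alpha z q >] = `[< sibling alpha z q' >].
  apply: asbool_equiv_eq; split=> h; first exact: sibling_trans qq'.
  by apply: sibling_trans h _; exact: sibling_sym.
lia.
Qed.

(** An element of nonnegative value at [p], written with coprime numerator and
    denominator, has a denominator outside the ideal of [p]. *)
Lemma localize_point p : vertices p ->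
  localize (T \bot) (M \bot p) = [set x | x != 0 -> 0 <= v p x].
Proof.
move=> pV; apply/seteqP; split=> [_ [a Ta [s [Ts nMs] <-]]|x] /=.
  rewrite mulf_eq0 negb_or => /andP[a0 sV0]; rewrite invr_eq0 in sV0.
  have vs : v p s = 0.
    apply/eqP; rewrite eq_le Ts ?le0x // andbT leNgt; apply/negP => h.
    by apply: nMs; split.
  by rewrite (pvalM H) ?invr_eq0 // (pvalV H) // vs oppr0 addr0 Ta ?le0x.
have [-> _|x0 /(_ isT) vx] := eqVneq x 0.
  exists 0; first exact: height_ring0.
  by exists 1; rewrite ?mul0r //; split; [exact: height_ring1|exact: point_ideal_proper].
have [m [n [u [Uu co ex]]]] := repr_coprime H x0.
have n0 : mval p n = 0%N by move: vx; rewrite ex (pvalE H) //; case: (co p pV); lia.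
exists (u * X m); first by apply: height_ringM => //; [exact: height_ring_U|exact: height_ring_X].
exists (X n); last by rewrite ex.
split; first exact: height_ring_X.
by move=> [_ /(_ (X0 n))]; rewrite (pval_X H) // n0 ltxx.
Qed.

Lemma inter_loc_points beta (C : set (set K)) :
  C = [set M \bot p | p in [set p | vertices p /\ (beta <= p.1)%O]] ->
  inter_loc (T \bot) C = T beta.
Proof.
move=> ->; apply/seteqP; split=> x.
  move=> Cx x0 p pV bp; have := Cx (M \bot p).
  by rewrite localize_point //; apply => //; exists p.
by move=> Tx _ [p [pV bp] <-]; rewrite localize_point // => /= x0; exact: Tx.
Qed.

Lemma span_point_ideal beta p : vertices p -> (beta <= p.1)%O ->
  ideal_span (T beta) (M \bot p) = M beta p.
Proof.
move=> pV bp; apply/seteqP; split.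
  apply: span_sub; first exact: point_ideal_ideal.
  by move=> x [Tx Mx]; split=> //; apply: height_ring_le Tx; exact: le0x.
move=> x [Tx Mx] J [[_ J0 _ JM] MJ].
have [->|x0] := eqVneq x 0; first exact: J0.
have [m [w [ex w0 Tw _ vx]]] := height_ring_decomp H Tx x0.
rewrite ex; apply: JM => //; apply: MJ; apply: point_ideal_X => //.
by move: (Mx x0); rewrite vx.
Qed.

Lemma pval_ideal_sqr beta q x : vertices q -> (beta <= q.1)%O ->
  ideal_sqr (T beta) (M beta q) x -> x != 0 -> 2%:Z <= v q x.
Proof.
move=> qV bq; pose J := [set y | T beta y /\ (y != 0 -> 2%:Z <= v q y)].
suff h : ideal_sqr (T beta) (M beta q) `<=` J by move=> /h[].
apply: span_sub.
  split.
  - by move=> y [].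
  - by split; [exact: height_ring0|rewrite eqxx].
  - move=> y z [Ty Jy] [Tz Jz]; split; first exact: (height_ringD H).
    have [->|y0] := eqVneq y 0; first by rewrite add0r.
    have [->|z0] := eqVneq z 0; first by rewrite addr0.
    move=> yz0; apply: le_trans (pvalD H qV y0 z0 yz0).
    by rewrite le_min Jy ?Jz.
  - move=> a y Ta [Ty Jy]; split; first exact: (height_ringM H).
    rewrite mulf_eq0 negb_or => /andP[a0 y0].
    by rewrite (pvalM H) // ler_wpDl // ?Ta ?Jy.
move=> _ [y [Ty My] [z [Tz Mz] <-]]; split; first exact: (height_ringM H).
rewrite mulf_eq0 negb_or => /andP[y0 z0]; rewrite (pvalM H) //.
by have := My y0; have := Mz z0; lia.
Qed.

(** Among the points of T_beta, those of height at least [beta = p.1], the vertex of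
    [p] has value 1 at its own and 0 at all others. *)
Lemma not_critical p : vertices p -> ~ CritMax (T p.1) (M p.1 p).
Proof.
move=> pV [_ crit]; have pa : (p.1 < alpha)%O by case: pV.
pose A := [set X (vertex_mon alpha p)].
have [||N maxN AN] := crit (ideal_span (T p.1) A).
- exists A; split=> //; first exact: finite_set1.
  by move=> _ ->; exact: height_ring_X.
- apply: span_sub; first exact: point_ideal_ideal.
  by move=> _ ->; apply: point_ideal_X => //; rewrite mval_vertex_self.
have [q [qV pq] eN] := height_ring_Max pa maxN; rewrite eN in AN.
have /(pval_ideal_sqr qV pq)/(_ (X0 _)) := AN _ (sub_span (erefl : A (X (vertex_mon alpha p)))).
by rewrite (pval_X H) // mval_vertex //; case: asbool.
Qed.

(** Finitely many elements of the ideal of [p] share a monomial factor of positive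
    value, the gcd of their monomial parts. *)
Lemma common_monomial beta p (A : set K) : vertices p -> (beta <= p.1)%O ->
  finite_set A -> A `<=` M beta p ->
  exists2 g, (0 < mval p g)%N & forall a, A a -> exists2 t, T beta t & a = X g * t.
Proof.
move=> pV bp /finite_seqP[s ->]; elim: s => [|a s IH] As.
  by exists (vertex_mon alpha p) => [|a]; rewrite /= ?mval_vertex_self.
have [|g pg gP] := IH; first by move=> b bs; apply: As; rewrite /= inE [_ \in s]bs orbT.
have Ma : M beta p a by apply: As; rewrite /= mem_head.
have [a0|a0] := eqVneq a 0.
  exists g => // b; rewrite /= inE => /predU1P[->|/gP //].
  by exists 0; [exact: height_ring0|rewrite mulr0].
have [m [w [ea w0 Tw _ va]]] := height_ring_decomp H Ma.1 a0.
have [l [m' [g' [em eg co]]]] := monomial_gcd m g.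
exists l.
  have := Ma.2 a0; rewrite va //; move: pg; rewrite em eg !mvalM //.
  by case: (co p pV); lia.
move=> b; rewrite /= inE => /predU1P[->|/gP[t Tt ->]].
  exists (w * X m'); first by apply: (height_ringM H) => //; exact: height_ring_X.
  by rewrite ea em XM mulrCA.
exists (X g' * t); first by apply: (height_ringM H) => //; exact: height_ring_X.
by rewrite eg XM mulrA.
Qed.

(** A monomial of positive value at [p] has a factor [X y] with [y] of height at
    least that of [p], hence above [beta]; a child [z] of [y] still of height at
    least [beta] gives the maximal ideal, as [X z] divides [X y] twice. *)
Lemma critical beta p : vertices p -> (beta < p.1)%O -> CritMax (T beta) (M beta p).
Proof.
move=> pV bp; split; first by apply: point_ideal_max => //; exact: ltW.
move=> I [A [finA AT ->]] AM.
have AM' : A `<=` M beta p by apply: subset_trans AM; exact: sub_span.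
have [g pg gP] := common_monomial pV (ltW bp) finA AM'.
have [y yV [by' [k ek]]] : exists2 y, vertices y &
    (beta < y.1)%O /\ exists k, g = mmul (vertex_mon alpha y) k.
  elim/(@monomial_ind d W alpha): g pg {gP} => [|y k yV IH]; first by rewrite mval1.
  rewrite mvalM //; have [yp|py _] := ltP y.1 p.1; last first.
    by exists y => //; split; [exact: lt_le_trans py|exists k].
  rewrite mval_vertex_lt // add0n => /IH[z zV [bz [l ->]]].
  exists z => //; split=> //; exists (mmul (vertex_mon alpha y) l).
  by rewrite !mulmA [mmul (vertex_mon _ y) _]mulmC.
have [z yz bz] := exists_edge yV by'; have zV := edge_vertex yz.
have [l el] := vertex_mon_edge yz.
exists (M beta z); first exact: point_ideal_max.
have sub : [set x * y | x in M beta z & y in M beta z] `<=` T beta.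
  by move=> _ [a [Ta _] [b [Tb _] <-]]; exact: (height_ringM H).
have [_ _ _ sqrM] := span_ideal (height_ring_subring H beta) sub.
apply: span_sub; first exact: span_ideal (height_ring_subring H beta) sub.
move=> a /gP[t Tt ->]; rewrite mulrC; apply: (sqrM) => //.
rewrite ek el !XM.
rewrite (_ : _ * _ = (X l * X k) * (X (vertex_mon alpha z) * X (vertex_mon alpha z)));
  last by ring.
apply: sqrM; first by apply: (height_ringM H); exact: height_ring_X.
by apply: sub_span; exists (X (vertex_mon alpha z)); [|exists (X (vertex_mon alpha z))];
  rewrite //; apply: point_ideal_X => //; rewrite mval_vertex_self.
Qed.

(** At [beta = osucc gamma] the points of height [gamma] drop out: they are not
    critical in T_gamma.  A lower point no longer generates a maximal ideal, as its
    vertex is a unit of T_gamma.  At a limit height a point of height [h] has been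
    lost at [osucc h]; the vertex of height [h] in its ideal shows that no higher
    point has the same ideal. *)
Lemma Crit_height beta : (\bot < alpha)%O -> (beta <= alpha)%O ->
  Crit (T \bot) beta = [set M \bot p | p in [set p | vertices p /\ (beta <= p.1)%O]].
Proof.
move=> a0; have M_higher beta' p q : vertices p -> vertices q -> (p.1 < q.1)%O ->
    ~ M beta' q (X (vertex_mon alpha p)).
  by move=> pV qV pq [_ /(_ (X0 _))]; rewrite (pval_X H) // mval_vertex_lt // ltxx.
elim/(well_founded_ind (@ord_lt_wf d W)): beta => beta IH ba.
have MaxD N : Max (T \bot) N <-> exists2 p, vertices p & N = M \bot p.
  split=> [/(height_ring_Max a0)[p [pV _] e]|[p pV ->]]; first by exists p.
  by apply: point_ideal_max => //; exact: le0x.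
case: (ord_cases beta) => [b0|[gamma eb]|bl].
- rewrite b0 Crit0; apply/seteqP; split=> [N /MaxD[p pV ->]|_ [p [pV _] <-]].
    by exists p => //; split=> //; exact: le0x.
  by apply/MaxD; exists p.
- have gb : (gamma < beta)%O by rewrite eb lt_osucc.
  have ga : (gamma < alpha)%O by exact: lt_le_trans ba.
  rewrite eb CritS /overT (inter_loc_points (IH _ gb (ltW ga))).
  apply/seteqP; split=> [N [/MaxD[p pV ->]] crit|_ [p [pV gp] <-]].
    exists p => //; split=> //; rewrite osucc_le ltNge; apply/negP => pg.
    have [maxJ _] := crit; have [q [qV gq] eJ] := height_ring_Max ga maxJ.
    move: pg; rewrite le_eqVlt => /predU1P[e|pg].
      rewrite span_point_ideal -?e // in crit; exact: not_critical crit.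
    apply: (@M_higher gamma p q) => //; first exact: lt_le_trans gq.
    by rewrite -eJ; apply: sub_span; apply: point_ideal_X => //; rewrite mval_vertex_self.
  rewrite osucc_le in gp; split; first by apply: point_ideal_max => //; exact: le0x.
  by rewrite span_point_ideal ?ltW //; exact: critical.
- have b0 := limit_gt0 bl.
  rewrite Crit_limit //; apply/seteqP; split=> [N NC|_ [p [pV bp] <-] gamma /= gb].
    have := NC _ b0; rewrite IH ?le0x // => -[p [pV _] eN].
    exists p => //; split=> //; rewrite leNgt; apply/negP => pb.
    have sb := limit_osucc bl pb.
    have := NC _ sb; rewrite IH ?(le_trans (ltW sb)) // => -[q [qV]].
    rewrite osucc_le => pq eN'; apply: (@M_higher \bot p q) => //.
    by rewrite eN' -eN; apply: point_ideal_X => //; rewrite mval_vertex_self.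
  rewrite IH ?(le_trans (ltW gb)) //; exists p => //; split=> //.
  by apply: le_trans bp; exact: ltW.
Qed.

End Maximal.

(** * The quotient field of F[X] and the domain D *)

Section FractionField.
Context {d : Order.disp_t} {W : ordinalsType d} (alpha : W).
Local Open Scope ring_scope.
Context (A : idomainType) (K : fieldType) (iota : {rmorphism A -> K}).
Context (X : monomial alpha -> A) (S : set A).
Hypothesis iota_inj : injective iota.
Hypothesis iota_frac : forall x, exists a b, b != 0 /\ x = iota a / iota b.
Implicit Types (m n k : monomial alpha) (f g h : A).

Hypothesis X1 : X mone = 1.
Hypothesis XM : forall m n, X (mmul m n) = X m * X n.
Hypothesis X0 : forall m, X m != 0.
Hypothesis S1 : S 1.
Hypothesis SM : forall f g, S f -> S g -> S (f * g).
Hypothesis S0 : forall f, S f -> f != 0.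
Hypothesis contentP : forall f, f != 0 -> exists m g, S g /\ f = X m * g.
Hypothesis content_inj : forall m n f g, S f -> S g -> X m * f = X n * g -> m = n.
Hypothesis S_coprime : forall m n, m != n -> coprime_mon m n -> S (X m + X n).

Let XK m : K := iota (X m).
Definition content_unit : set K :=
  [set x | exists f g, [/\ S f, S g & x = iota f / iota g]].

Let iota_eq0 f : (iota f == 0) = (f == 0).
Proof. by rewrite -(rmorph0 iota) (inj_eq iota_inj). Qed.

Let SK0 f : S f -> iota f != 0.
Proof. by move=> /S0; rewrite iota_eq0. Qed.

Lemma fraction_content_theory : content_theory XK content_unit.
Proof.
split.
- by rewrite /XK X1 rmorph1.
- by move=> m n; rewrite /XK XM rmorphM.
- by move=> m; rewrite iota_eq0.
- by exists 1, 1; rewrite rmorph1 divr1.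
- move=> _ _ [f [g [Sf Sg ->]]] [f' [g' [Sf' Sg' ->]]].
  exists (f * f'), (g * g'); split; [exact: SM|exact: SM|].
  by rewrite !rmorphM mulf_div.
- by move=> _ [f [g [Sf Sg ->]]]; exists g, f; rewrite invf_div.
- by move=> _ [f [g [Sf Sg ->]]]; rewrite mulf_neq0 ?invr_eq0 ?SK0.
- move=> x; have [a [b [b0 ->]]] := iota_frac x.
  rewrite mulf_eq0 invr_eq0 !iota_eq0 (negPf b0) orbF => a0.
  have [m [f [Sf ->]]] := contentP a0; have [n [g [Sg ->]]] := contentP b0.
  exists m, n, (iota f / iota g); split; first by exists f, g.
  by rewrite /XK !rmorphM invfM; ring.
- move=> m n _ _ [f [g [Sf Sg ->]]] [f' [g' [Sf' Sg' ->]]] e.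
  apply: (content_inj (SM Sf Sg') (SM Sf' Sg)).
  apply: iota_inj; rewrite !rmorphM.
  have g0 := SK0 Sg; have g0' := SK0 Sg'.
  have := congr1 (fun z => z * (iota g * iota g')) e.
  have -> : iota f / iota g * XK m * (iota g * iota g') =
      iota (X m) * (iota f * iota g') by rewrite /XK; field.
  have -> : iota f' / iota g' * XK n * (iota g * iota g') =
      iota (X n) * (iota f' * iota g) by rewrite /XK; field.
  by [].
- move=> m n _ _ [f [g [Sf Sg ->]]] [f' [g' [Sf' Sg' ->]]].
  have g0 := SK0 Sg; have g0' := SK0 Sg'.
  pose h := X m * (f * g') + X n * (f' * g).
  have -> : iota f / iota g * XK m + iota f' / iota g' * XK n =
      iota h / iota (g * g').
    by rewrite /h /XK rmorphD !rmorphM; field; rewrite g0' g0.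
  have [->|h0 _] := eqVneq h 0; first by rewrite rmorph0 mul0r eqxx.
  have [k [t [St eh]]] := contentP h0.
  exists k, (iota t / iota (g * g')); split.
    by exists t, (g * g'); split=> //; exact: SM.
  by rewrite eh !rmorphM /XK; ring.
- move=> m n mn co; exists (X m + X n), 1; split=> //; first exact: S_coprime.
  by rewrite rmorph1 divr1 rmorphD.
Qed.

(** Nonnegative value at every point forces the reduced denominator to be 1. *)
Lemma fraction_height_ring :
  [set x : K | exists f s, S s /\ x = iota f / iota s] =
  height_ring XK content_unit \bot.
Proof.
have H := fraction_content_theory.
have US f : S f -> content_unit (iota f).
  by move=> Sf; exists f, 1; rewrite rmorph1 divr1.
apply/seteqP; split=> [_ [f [s [Ss ->]]]|x Tx].
  apply: (height_ringM H).
    have [->|f0] := eqVneq f 0; first by rewrite rmorph0; exact: height_ring0.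
    have [m [g [Sg ->]]] := contentP f0; rewrite rmorphM; apply: (height_ringM H).
      exact: (height_ring_X H).
    by apply: (height_ring_U H); exact: US.
  by apply: (height_ring_U H); apply: (content_UV H); exact: US.
have [->|x0] := eqVneq x 0; first by exists 0, 1; rewrite rmorph0 mul0r.
have [m [n [u [Uu co ex]]]] := repr_coprime H x0.
have [f [g [Sf Sg eu]]] := Uu.
have n1 : n = mone.
  apply: contrapT => /mval_proper[p pV pn].
  have := Tx x0 p pV (le0x _); rewrite ex (pvalE H) //.
  by case: (co p pV); lia.
exists (X m * f), g; split=> //.
by rewrite ex n1 eu (content_X1 H) divr1 rmorphM; ring.
Qed.

Lemma fraction_content :
  content_theory XK content_unit /\
  [set x : K | exists f s, S s /\ x = iota f / iota s] =
  height_ring XK content_unit \bot.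
Proof. split; [exact: fraction_content_theory|exact: fraction_height_ring]. Qed.

End FractionField.

Section PolynomialFractions.
Context {d : Order.disp_t} {W : ordinalsType d} (alpha : W) (F : fieldType).
Hypothesis alpha_gt0 : \bot < alpha.
Local Open Scope ring_scope.

Let XA (m : monomial alpha) : polyX alpha F := mon_elt F m.
Let XD (m : monomial alpha) : {fraction polyX alpha F} := tofrac (XA m).
Let iota : {rmorphism polyX alpha F -> {fraction polyX alpha F}} :=
  @FracField.tofrac (polyX alpha F).
Let UD := content_unit iota (Sset alpha F).

Lemma polyX_content :
  content_theory XD UD /\ domD alpha F = height_ring XD UD \bot.
Proof.
apply: (@fraction_content _ _ alpha (polyX alpha F) _ iota XA (Sset alpha F)).
- by move=> f g /eqP; rewrite tofrac_eq => /eqP.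
- exact: fracP.
- exact: mon_elt1.
- exact: mon_eltM.
- exact: mon_elt_neq0.
- exact: Sset1.
- exact: SsetM.
- exact: Sset_neq0.
- move=> f /content_exists[k [g [eg gP]]]; exists k, g; split=> //.
  exact/SsetP.
- exact: content_part_unique.
- exact: Sset_add_coprime.
Qed.

End PolynomialFractions.

Theorem theorem5p4 (d : Order.disp_t) (W : ordinalsType d) (alpha : W)
    (alpha_gt0 : (\bot < alpha)%O) (F : fieldType) :
  is_almost_dedekind (domD alpha F) /\ has_SP_rank (domD alpha F) alpha.
Proof.
have [H ->] := polyX_content F alpha_gt0; split.
  split; first exact: (height_ring_subring H).
  move=> N /(height_ring_Max H alpha_gt0)[p [pV _] ->]; rewrite (localize_point H pV).
  by eexists; first exact: (pval_discrete H pV).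
split; first rewrite (Crit_height H) //.
  by apply/seteqP; split=> // N [p [[pa _] ap] _]; move: pa; rewrite ltNge ap.
move=> gamma ga; rewrite (Crit_height H) ?ltW //; have [p pV ep] := exists_vertex ga.
by apply/eqP/set0P; eexists; exists p; [split=> //; rewrite ep|reflexivity].
Qed.
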